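(* For every $n\ge 5$, the automorphism group of the network realignment complex $X_n$ satisfies $\operatorname{Aut}(X_n)\cong S_n$, where $S_n$ is the symmetric group on $n$ letters.
   Context: A network realignment $N=(T,r)$ over the complete graph $K_n$ with vertex set $[n]=\{1,\dots,n\}$ consists of a partition $[n]=A\sqcup B$ with $|A|\ge 2$ ($B$ may be empty), a tree $T$ with vertex set $A$, and a map $r\colon B\to E(T)$. For $b\in B$ and an endpoint $v$ of $r(b)$, the specification $N^{b\to v}$ is the network realignment with partition $A\cup\{b\}$, $B\setminus\{b\}$, tree obtained from $T$ by adding the vertex $b$ and the edge $(v,b)$, and map $r|_{B\setminus\{b\}}$. The network realignment complex $X_n=X_{K_n}$ is the finite cubical complex whose face poset is the set of all network realignments over $K_n$ with partial order generated by $N\succ N^{b\to v}$; the cell indexed by $N$ is a cube of dimension $|B|$. $\operatorname{Aut}(X_n)$ is the group of automorphisms of the cubical complex (equivalently, of its face poset). *)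

(* Defs.v *)
From HB Require Import structures.
From mathcomp Require Import all_boot all_order all_fingroup.

Set Implicit Arguments.
Unset Strict Implicit.
Unset Printing Implicit Defensive.

Section Trees.
Variable V : finType.
Implicit Types (A : {set V}) (E : {set {set V}}).

Definition adj E : rel V := fun x y => [set x; y] \in E.

Definition edges_on A E : bool :=
  [forall e in E, (e \subset A) && (#|e| == 2)].

Definition connected_on A E : bool :=
  [forall x in A, forall y in A, connect (adj E) x y].

(* A cycle is a closed sequence of at least three pairwise distinct vertices;
   having no repetition, it has length at most #|V|. *)
Definition acyclic E : bool :=
  [forall c : #|V|.-bseq V, (2 < size c) ==> ~~ ucycleb (adj E) c].

Definition is_tree A E : bool :=
  [&& edges_on A E, connected_on A E & acyclic E].

Lemma acyclicP E :
  reflect (forall c : seq V, ucycle (adj E) c -> size c <= 2) (acyclic E).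
Proof.
apply: (iffP forallP) => [acE c ucE | acE c]; last first.
  by apply/implyP => c_gt2; apply/negP => /acE; rewrite leqNgt c_gt2.
have c_le : size c <= #|V|.
  by case/andP: ucE => _ Uc; rewrite -(card_uniqP Uc) max_card.
rewrite leqNgt; apply/negP => c_gt2.
by have := acE (Bseq c_le); rewrite /= c_gt2 /= => /negP; apply.
Qed.

Lemma adj_sym E : symmetric (adj E).
Proof. by move=> x y; rewrite /adj setUC. Qed.

Lemma set2_inj_r (b x y : V) : [set b; x] = [set b; y] -> x = y.
Proof.
move=> eq_bxy.
have: x \in [set b; y] by rewrite -eq_bxy !inE eqxx orbT.
have: y \in [set b; x] by rewrite eq_bxy !inE eqxx orbT.
by rewrite !inE => /orP[] /eqP-> // /orP[] /eqP.
Qed.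

Lemma is_tree_leaf A E (v b : V) :
  is_tree A E -> v \in A -> b \notin A -> is_tree (b |: A) ([set v; b] |: E).
Proof.
case/and3P=> /forall_inP eE /forall_inP cE /acyclicP aE Av nAb.
have vb : v != b by apply: contraNneq nAb => <-.
have sub_adj : subrel (adj E) (adj ([set v; b] |: E)).
  by move=> x y; rewrite /adj inE => ->; rewrite orbT.
have sub_con : subrel (connect (adj E)) (connect (adj ([set v; b] |: E))).
  by apply: connect_sub => x y /sub_adj; apply: connect1.
have nEb x : adj E b x = false.
  apply/negP => /eE /andP[/subsetP/(_ b) sA _].
  by move: nAb; rewrite sA // !inE eqxx.
have adjb x : adj ([set v; b] |: E) b x -> x = v.
  rewrite {1}/adj inE => /orP[/set1P | ]; last by rewrite -/(adj E b x) nEb.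
  by rewrite [RHS]setUC => /set2_inj_r.
have adj_bv : adj ([set v; b] |: E) b v by rewrite /adj setUC setU11.
have csym := sym_connect_sym (adj_sym ([set v; b] |: E)).
have con_v x : x \in b |: A -> connect (adj ([set v; b] |: E)) v x.
  case/setU1P=> [-> | Ax]; first by rewrite csym connect1.
  by apply: sub_con; have /forall_inP/(_ x Ax) := cE v Av.
apply/and3P; split.
- apply/forall_inP => e /setU1P[-> | /eE /andP[sA ->]]; last first.
    by rewrite (subset_trans sA) ?subsetUr.
  rewrite cards2 vb eqxx andbT; apply/subsetP => x /set2P[] ->.
    by rewrite !inE Av orbT.
  by rewrite !inE eqxx.
- apply/forall_inP => x Ax; apply/forall_inP => y Ay.
  by rewrite (connect_trans _ (con_v y Ay)) // csym con_v.
apply/acyclicP => c ucE; have [bc | nbc] := boolP (b \in c); last first.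
  apply: aE; case/andP: ucE => cyc Uc; apply/andP; split => //.
  apply: (sub_in_cycle (P := [in c])) cyc; last exact/allP.
  move=> x y xc yc; rewrite {1}/adj inE => /orP[/set1P eq_xy | //].
  have: b \in [set x; y] by rewrite eq_xy !inE eqxx orbT.
  by case/set2P=> b_eq; move: nbc; rewrite b_eq ?xc ?yc.
case/andP: ucE => cyc Uc; have [i c' def_c] := rot_to bc.
rewrite -(size_rot i); rewrite -(rot_cycle i) in cyc; rewrite -(rot_uniq i) in Uc.
case: c' def_c cyc Uc => [|x c'] -> //=.
rewrite rcons_path => /and3P[/adjb-> _ ].
rewrite adj_sym => /adjb last_v /and3P[_ + _].
by case/lastP: c' last_v => [|p z] //; rewrite last_rcons mem_rcons => ->; rewrite mem_head.
Qed.
End Trees.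

(* Data (A, E(T), r) on the vertex set 'I_n; B is the complement of A and r is
   encoded as a partial function with domain B (None exactly on A). *)
Definition realign_data n :=
  ({set 'I_n} * {set {set 'I_n}} * {ffun 'I_n -> option {set 'I_n}})%type.

Section Data.
Variable n : nat.
Implicit Types d : realign_data n.

Definition tree_verts d : {set 'I_n} := d.1.1.
Definition tree_edges d : {set {set 'I_n}} := d.1.2.
Definition reattach d : {ffun 'I_n -> option {set 'I_n}} := d.2.

Definition is_realignment d : bool :=
  [&& 2 <= #|tree_verts d|,
      is_tree (tree_verts d) (tree_edges d)
    & [forall b, if reattach d b is Some e
                 then (b \notin tree_verts d) && (e \in tree_edges d)
                 else b \in tree_verts d]].

(* N^{b -> v}, for b in B and v an endpoint of r(b). *)
Definition specify_data d (b v : 'I_n) : realign_data n :=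
  (b |: tree_verts d, [set v; b] |: tree_edges d,
   [ffun x => if x == b then None else reattach d x]).

Lemma is_realignment_specify d b v e :
  is_realignment d -> reattach d b = Some e -> v \in e ->
  is_realignment (specify_data d b v).
Proof.
case/and3P=> A_ge2 treeT /forallP rP rb ve.
have /andP[nAb Ee] : (b \notin tree_verts d) && (e \in tree_edges d).
  by have := rP b; rewrite rb.
have Av : v \in tree_verts d.
  case/and3P: treeT => /forall_inP/(_ e Ee)/andP[sA _] _ _.
  exact: subsetP sA v ve.
apply/and3P; split; last 1 first.
- apply/forallP => x; rewrite /reattach /= ffunE; case: eqP => [-> | /eqP xb].
    exact: setU11.
  have := rP x; rewrite -/(reattach d); case: (reattach d x) => [f|] /=.
    by case/andP=> nAx Ef; rewrite in_setU1 negb_or xb nAx setU1r.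
  exact: setU1r.
- by rewrite cardsU1 nAb (leq_trans A_ge2) ?leq_addl.
exact: is_tree_leaf.
Qed.

End Data.

Record realignment n := Realignment {
  realign_val :> realign_data n;
  _ : is_realignment realign_val
}.

HB.instance Definition _ n := [isSub for @realign_val n].
HB.instance Definition _ n := [Finite of realignment n by <:].

Section FacePoset.
Variable n : nat.
Implicit Types N M : realignment n.

(* M = N^{b -> v} for some b in B and some endpoint v of r(b). *)
Definition specializes : rel (realignment n) := fun N M =>
  [exists b, exists v,
    (if reattach N b is Some e then v \in e else false)
    && (val M == specify_data N b v)].

Definition face_le : rel (realignment n) := fun M N => connect specializes N M.

Lemma specializes_card N M :
  specializes N M -> #|tree_verts N| < #|tree_verts M|.
Proof.
case/existsP=> b /existsP[v /andP[+ /eqP defM]].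
case: N defM => d /= dP defM; case/and3P: (dP) => _ _ /forallP/(_ b).
case: (reattach d b) => // e /andP[nAb _] _.
by rewrite defM cardsU1 nAb.
Qed.

Lemma face_le_card M N :
  face_le M N -> M != N -> #|tree_verts N| < #|tree_verts M|.
Proof.
case/connectP=> p; elim: p N => [|K p IHp] N /=; first by move=> _ ->; rewrite eqxx.
case/andP=> /specializes_card ltNK pathp defM _.
have [-> // | neqMK] := eqVneq M K.
exact: ltn_trans ltNK (IHp K pathp defM neqMK).
Qed.

Lemma face_le_refl : reflexive face_le.
Proof. by move=> N; apply: connect0. Qed.

Lemma face_le_trans : transitive face_le.
Proof. by move=> N M K leMN leNK; apply: connect_trans leNK leMN. Qed.

Lemma face_le_anti : antisymmetric face_le.
Proof.
move=> M N /andP[leMN leNM]; apply/eqP/negPn/negP => neqMN.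
have := ltn_trans (face_le_card leMN neqMN).
by move/(_ _ (face_le_card leNM _)); rewrite eq_sym neqMN ltnn => /(_ isT).
Qed.

End FacePoset.

Fact face_display : Order.disp_t. Proof. exact: Order.Disp tt tt. Qed.

(* [realignment n] with this order is the face poset of the complex X_n. *)
HB.instance Definition _ n := Order.Le_isPOrder.Build face_display
  (realignment n) (@face_le_refl n) (@face_le_anti n) (@face_le_trans n).

Lemma leEface n (M N : realignment n) :
  (M <= N)%O = connect (@specializes n) N M.
Proof. by []. Qed.

Section PosetAut.
Variables (disp : Order.disp_t) (P : finPOrderType disp).

Definition poset_aut : {set {perm P}} :=
  [set s : {perm P} | [forall x, forall y, (s x <= s y)%O == (x <= y)%O]].

Lemma poset_autP (s : {perm P}) :
  reflect {mono s : x y / (x <= y)%O} (s \in poset_aut).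
Proof.
rewrite inE; apply: (iffP forallP) => [sP x y | sP x].
  by have /forallP/(_ y)/eqP := sP x.
by apply/forallP => y; rewrite sP.
Qed.

Lemma poset_aut_group_set : group_set poset_aut.
Proof.
apply/group_setP; split=> [|s t /poset_autP sP /poset_autP tP].
  by apply/poset_autP => x y; rewrite !perm1.
by apply/poset_autP => x y; rewrite !permM tP sP.
Qed.

Canonical poset_aut_group := Group poset_aut_group_set.

End PosetAut.

(* Automorphisms of the complex X_n, as automorphisms of its face poset. *)
Definition AutX n : {group {perm realignment n}} :=
  [group of poset_aut (realignment n)].

(* Main.v *)
Require Import Defs.
From mathcomp Require Import all_boot all_order all_fingroup.
From mathcomp Require Import zify.

(** Permutations of the labels act on the complex, and the content of the
    theorem is that there is nothing else.

    The cubes of largest dimension, or top cubes, are those whose tree is a single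
    edge [{u, v}], all other labels sliding along it; an automorphism preserves
    dimension, hence permutes them. A vertex of the complex that lies in two of
    them is a star (a tree with all edges at one centre), and each star does lie
    in two of them, so an automorphism permutes the [n] stars
    ([vertex_in_two_tops], [aut_star_perm]). Correcting it by the corresponding
    relabelling, one is left to show that an automorphism [phi] fixing all stars
    is the identity ([fix_cell]).

    The first step looks at the link of the star at [u]. Its edges towards
    neighbours are indexed by pairs [(v, b)]: the leaf [b] slides from [u] to
    [v]. As [phi] fixes the top cube on [{u, v}], it can only permute the labels
    [b] within each class [v]. For another class [v'], the edge [(v, v')] is the
    only one in class [v] that spans a square with no edge of class [v'], because
    [v'] cannot slide and at the same time carry a sliding leaf; any other edge
    [(v, b)] spans a square with [(v', b')] for a fifth label [b'], and this is
    where [n >= 5] enters. So [phi] fixes all neighbours of stars ([fix_slide]).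

    The second step propagates this to all trees. If a rooted tree has two leaves
    at depth at least two, moving either or both one step towards the root gives
    the three other vertices of a square, so it is fixed as soon as these are
    ([fixed_square]); they have a smaller sum of depths. If it has only one such
    leaf, it is a path with further leaves attached to the root, and taking the
    next vertex of the path as root makes it less high, unless it is a star or a
    neighbour of one. Induction on the height, then on the sum of depths,
    concludes ([fixed_tree_height]). A cube is determined by its vertices: an
    edge by its ends ([edge_unique]), a larger one by two facets
    ([eq_of_two_faces]). *)

Set Implicit Arguments.
Unset Strict Implicit.
Unset Printing Implicit Defensive.

Import Order.TTheory.

Local Notation tv := tree_verts.
Local Notation te := tree_edges.
Local Notation ra := reattach.

(** * Trees as parent functions *)

Section RootedTrees.
Variable V : finType.
Implicit Types (c b x y : V) (A : {set V}) (E : {set {set V}}).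
Implicit Types (p : V -> V) (d : V -> nat).

Definition parent_edges c A p : {set {set V}} :=
  [set [set p x; x] | x in A :\ c].

(** The depth function is what makes iterated parents reach the root [c]. *)
Definition rooted c A p d : Prop :=
  [/\ c \in A, d c = 0
    & {in A :\ c, forall x, p x \in A /\ d x = (d (p x)).+1}].

Lemma parent_edgesP c A p e :
  reflect (exists2 x, x \in A :\ c & e = [set p x; x]) (e \in parent_edges c A p).
Proof. exact: imsetP. Qed.

Lemma mem_parent_edges c A p x :
  x \in A -> x != c -> [set p x; x] \in parent_edges c A p.
Proof. by move=> Ax xc; apply: imset_f; rewrite !inE xc. Qed.

Lemma rooted_depth0 c A p d x : rooted c A p d -> x \in A -> d x = 0 -> x = c.
Proof.
case=> _ _ dS Ax dx; apply/eqP/negPn/negP => xc.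
by case: (dS x); rewrite ?inE ?xc // dx.
Qed.

Lemma is_tree1 c : is_tree [set c] set0.
Proof.
apply/and3P; split.
- by apply/forall_inP => e; rewrite inE.
- by apply/forall_inP => x /set1P->; apply/forall_inP => y /set1P->; apply: connect0.
apply/acyclicP => -[|x [|y s]] //.
by case/andP => /= /andP[]; rewrite /adj inE.
Qed.

(** Remove a deepest vertex: it has no child, so it is a leaf, and the rest
    is a rooted tree on fewer vertices. *)
Lemma rooted_tree c A p d : rooted c A p d -> is_tree A (parent_edges c A p).
Proof.
have [k] := ubnP #|A|; elim: k A => // k IHk A ltA [Ac dc dS].
have [/eqP A1 | [x0 x0A]] := set_0Vmem (A :\ c).
  have -> : parent_edges c A p = set0 by rewrite /parent_edges (eqP A1) imset0.
  suff -> : A = [set c] by apply: is_tree1.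
  by rewrite -(setD1K Ac) (eqP A1) setU0.
pose b := [arg max_(x > x0 in A :\ c) d x].
have [bA bmax] : b \in A :\ c /\ {in A :\ c, forall x, d x <= d b}.
  by rewrite /b; case: (arg_maxnP d x0A) => y yA ymax; split.
have [pbA dbE] := dS b bA; have /setD1P[bc Ab] := bA.
have pbb : p b != b by apply/eqP => pb; move: dbE; rewrite pb; lia.
have rAb : rooted c (A :\ b) p d.
  split=> //; first by rewrite !inE eq_sym bc.
  move=> x; rewrite !inE => /and3P[xc xb Ax].
  have xA : x \in A :\ c by rewrite !inE xc.
  have [pxA dxE] := dS x xA; rewrite pxA andbT; split=> //.
  by apply/eqP => pxb; have := bmax x xA; rewrite dxE pxb ltnn.
have -> : parent_edges c A p = [set p b; b] |: parent_edges c (A :\ b) p.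
  by rewrite /parent_edges -(setD1K bA) imsetU1 !setDDl [[set c] :|: _]setUC.
rewrite -[X in is_tree X](setD1K Ab); apply: is_tree_leaf.
- by apply: IHk rAb; rewrite (cardsD1 b) Ab in ltA.
- by rewrite !inE pbb.
by rewrite !inE eqxx.
Qed.

Section TreeEdges.
Variables (A : {set V}) (E : {set {set V}}).
Hypothesis treeE : is_tree A E.

Lemma tree_edge e : e \in E -> (e \subset A) && (#|e| == 2).
Proof. by case/and3P: treeE => /forall_inP/(_ e). Qed.

Lemma tree_adj x y : adj E x y -> [/\ x \in A, y \in A & x != y].
Proof.
move=> /tree_edge; rewrite subUset !sub1set cards2 => /andP[/andP[-> ->]].
by case: (x != y).
Qed.

(** A path from [x] to [y] avoiding the edge [{x, y}] would close up to a
    cycle. *)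
Lemma tree_bridge x y :
  adj E x y -> ~~ connect (adj (E :\ [set x; y])) x y.
Proof.
move=> Exy; apply/negP => /connectP[q xq yq].
case/shortenP: xq yq => q' xq' Uq' _ {q} yq.
have /acyclicP/(_ (x :: q')) : acyclic E by case/and3P: treeE.
have [Ax Ay xy] := tree_adj Exy.
have subE : subrel (adj (E :\ [set x; y])) (adj E).
  by move=> u v; rewrite /adj !inE => /andP[].
case: q' xq' Uq' yq => [|z [|z' q]] /=; first by move=> _ _ yx; rewrite yx eqxx in xy.
  by move=> /andP[xz _] _ yz; rewrite /adj !inE -yz eqxx in xz.
move=> /and3P[xz zz' z'q] Uq yq le2; suff /le2: ucycle (adj E) [:: x, z, z' & q] by [].
apply/andP; split; last exact: Uq.
rewrite /= rcons_path (subE _ _ xz) (subE _ _ zz') (sub_path subE z'q) /=.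
by rewrite -yq adj_sym.
Qed.

End TreeEdges.

Definition upd (T : Type) (f : V -> T) b t x := if x == b then t else f x.

(** Connectedness lets a rooted subtree grow until it spans [A]. An edge of [E]
    that is not then a parent edge could be bypassed through the root,
    contradicting [tree_bridge]. *)
Lemma tree_rooted A E c : is_tree A E -> c \in A ->
  exists p d, rooted c A p d /\ E = parent_edges c A p.
Proof.
move=> treeE Ac.
suff [p [d [rA pE]]] : exists p d, rooted c A p d /\ parent_edges c A p \subset E.
  exists p, d; split=> //; apply/eqP; rewrite eqEsubset pE andbT.
  have [_ dc dS] := rA.
  apply/subsetP => e Ee; have /andP[eA /cards2P[x [y [xy def_e]]]] := tree_edge treeE Ee.
  have Exy : adj E x y by rewrite /adj -def_e.
  apply/negPn/negP => NEe; case/negP: (tree_bridge treeE Exy).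
  have [Ax Ay _] := tree_adj treeE Exy.
  suff con_c z : z \in A -> connect (adj (E :\ [set x; y])) c z.
    rewrite (connect_trans _ (con_c y Ay)) //.
    by rewrite (sym_connect_sym (adj_sym _)) con_c.
  have [k] := ubnP (d z); elim: k z => // k IHk z ltdz Az.
  have [-> | zc] := eqVneq z c; first exact: connect0.
  have zAc : z \in A :\ c by rewrite !inE zc.
  have [pzA dz] := dS z zAc.
  apply: connect_trans (IHk (p z) _ pzA) _; first by rewrite dz in ltdz.
  apply: connect1; rewrite /adj !inE -def_e.
  have pz : [set p z; z] \in parent_edges c A p by apply: mem_parent_edges.
  rewrite (subsetP pE) // andbT; by apply: contraNneq NEe => <-.
suff: forall S : {set V}, c \in S -> S \subset A ->
    (exists p d, rooted c S p d /\ parent_edges c S p \subset E) ->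
    exists p d, rooted c A p d /\ parent_edges c A p \subset E.
  apply; [exact: set11 | by rewrite sub1set |].
  exists id, (fun=> 0); split.
    by split=> // [|x]; rewrite ?set11 // !inE andNb.
  by rewrite /parent_edges setDv imset0 sub0set.
move=> S; have [k] := ubnP #|A :\: S|; elim: k S => // k IHk S ltk Sc SA [p [d [rS pE]]].
have [AS | nAS] := boolP (A \subset S).
  have -> : A = S by apply/eqP; rewrite eqEsubset AS.
  by exists p, d.
have [[x y] /= /and3P[Sx nSy Exy]] : exists u : V * V, [&& u.1 \in S, u.2 \notin S & adj E u.1 u.2].
  apply/existsP; apply: contraR nAS; rewrite negb_exists => /forallP/= noE.
  have clS : closed (adj E) (mem S).
    move=> x y Exy; apply/idP/idP => [xS | yS]; apply/negPn/negP => nS.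
      by case/negP: (noE (x, y)); rewrite /= [x \in S]xS nS.
    by case/negP: (noE (y, x)); rewrite /= [y \in S]yS nS adj_sym.
  apply/subsetP => y Ay; rewrite -[_ \in _](@closed_connect _ _ _ clS c) //.
  by case/and3P: treeE => _ /forall_inP/(_ c Ac)/forall_inP/(_ y Ay).
have [_ Ay xy] := tree_adj treeE Exy.
have [_ dc dS] := rS; have yc : y != c by apply: contraNneq nSy => ->.
apply: (IHk (y |: S)).
- have : A :\: (y |: S) \proper A :\: S.
    apply/properP; split; first by apply: setDS; apply: subsetUr.
    by exists y; rewrite !inE ?nSy // eqxx.
  by move=> /proper_card; lia.
- by rewrite !inE Sc orbT.
- by rewrite subUset sub1set Ay.
exists (upd p y x), (upd d y (d x).+1); split.
  split; first by rewrite !inE Sc orbT.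
    by rewrite /upd eq_sym (negPf yc).
  move=> z; rewrite !inE /upd => /andP[zc]; case: (eqVneq z y) => [_ _| zy /= Sz].
    by rewrite Sx orbT (negPf xy).
  have [|pz dz] := dS z; first by rewrite !inE zc.
  rewrite pz orbT dz; split=> //; case: eqP => // pzy.
  by move: nSy; rewrite -pzy pz.
apply/subsetP => e /parent_edgesP[z]; rewrite !inE /upd => /andP[zc].
case: (eqVneq z y) => [-> _ -> // | zy /= Sz ->].
by apply: (subsetP pE); apply: mem_parent_edges.
Qed.
End RootedTrees.

Section DeepLeaves.
Variable V : finType.
Implicit Types (c b x : V) (A : {set V}) (p : V -> V) (d : V -> nat).

Lemma updE (T : Type) (f : V -> T) b t : upd f b t b = t.
Proof. by rewrite /upd eqxx. Qed.

Lemma updNE (T : Type) (f : V -> T) b t x : x != b -> upd f b t x = f x.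
Proof. by rewrite /upd => /negPf->. Qed.

(** A leaf at distance at least two from the root, so that it can be moved from
    its parent to its grandparent. *)
Definition deep_leaf c p b :=
  [&& b != c, p b != c & [forall x, (x != c) ==> (p x != b)]].

Lemma deep_leafP c p b :
  reflect [/\ b != c, p b != c & forall x, x != c -> p x != b] (deep_leaf c p b).
Proof.
apply: (iffP and3P) => [] [bc pbc H]; split=> //; last by apply/forall_inP.
by move=> x; apply/implyP; move: x; apply/forallP.
Qed.

Lemma rooted_del c A p d b : rooted c A p d -> deep_leaf c p b ->
  rooted c (A :\ b) p d.
Proof.
case=> Ac dc dS /deep_leafP[bc _ bleaf]; split=> //; first by rewrite !inE eq_sym bc.
move=> x; rewrite !inE => /and3P[xc xb xA]; rewrite bleaf //.
by apply: dS; rewrite !inE xc.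
Qed.

Lemma rooted_raise c p d b : rooted c setT p d -> deep_leaf c p b ->
  rooted c setT (upd p b (p (p b))) (upd d b (d b).-1).
Proof.
case=> _ dc dS /deep_leafP[bc pbc bleaf].
have dS' x : x != c -> d x = (d (p x)).+1.
  by move=> xc; case: (dS x); rewrite ?inE ?xc.
split; rewrite ?inE // ?updNE 1?eq_sym // => x; rewrite !inE andbT => xc; split=> //.
have [-> | xb] := eqVneq x b.
  by rewrite !updE updNE ?bleaf // (dS' b bc) (dS' _ pbc).
by rewrite !(updNE _ _ xb) updNE ?bleaf // dS'.
Qed.

Lemma deep_leaf_raise c p b b' : deep_leaf c p b -> deep_leaf c p b' -> b != b' ->
  deep_leaf c (upd p b (p (p b))) b'.
Proof.
move=> /deep_leafP[bc pbc bleaf] /deep_leafP[b'c pb'c b'leaf] bb'.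
apply/deep_leafP; split=> //; first by rewrite updNE // eq_sym.
by move=> x xc; rewrite /upd; case: (x =P b) => _; apply: b'leaf.
Qed.

Lemma leaf_edge c A p b x : b \in A -> {in A :\ c, forall z, p z != b} ->
  [set x; b] \in parent_edges c A p -> x = p b.
Proof.
move=> Ab bleaf /parent_edgesP[z zA xbE].
have [zb | zb] := eqVneq z b.
  by move: xbE; rewrite zb setUC [RHS]setUC => /set2_inj_r.
have : b \in [set p z; z] by rewrite -xbE !inE eqxx orbT.
by rewrite !inE [b == z]eq_sym (negPf zb) orbF eq_sym (negPf (bleaf z zA)).
Qed.

End DeepLeaves.

Section Branches.
Variable V : finType.
Implicit Types (c b x : V) (p : V -> V) (d : V -> nat).

Lemma rooted_depth c p d x : rooted c setT p d -> x != c -> d x = (d (p x)).+1.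
Proof. by case=> _ _ dS xc; case: (dS x); rewrite ?inE ?xc. Qed.

Lemma depth_le1 c p d x : rooted c setT p d -> x != c -> d x <= 1 -> p x = c.
Proof.
move=> rT xc dx; apply: (rooted_depth0 rT); rewrite ?inE //.
by have := rooted_depth rT xc; lia.
Qed.

Lemma depth_ge2 c p d x : rooted c setT p d -> (2 <= d x) = (x != c) && (p x != c).
Proof.
move=> rT; have [-> | xc] := eqVneq x c; first by case: rT => _ ->.
rewrite (rooted_depth rT xc) ltnS lt0n; congr (~~ _).
apply/eqP/eqP => [/(rooted_depth0 rT) -> | ->]; rewrite ?inE //.
by case: rT.
Qed.

Lemma sum_depth_raise c p d b : rooted c setT p d -> b != c ->
  \sum_x upd d b (d b).-1 x < \sum_x d x.
Proof.
move=> rT bc; rewrite (bigD1 b) //= [X in _ < X](bigD1 b) //= updE.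
rewrite (eq_bigr d) => [|x xb]; last by rewrite updNE.
by rewrite ltn_add2r (rooted_depth rT bc).
Qed.

(** The child of the root below which [x] lies. *)
Definition branch p d x := iter (d x).-1 p x.

Lemma branch_parent c p d x : rooted c setT p d -> 2 <= d x ->
  branch p d x = branch p d (p x).
Proof.
move=> rT dx; have := dx; rewrite (depth_ge2 _ rT) => /andP[xc pxc].
rewrite /branch (rooted_depth rT xc) /= (rooted_depth rT pxc) /=.
by rewrite -iterSr.
Qed.

Lemma depth_branch c p d x : rooted c setT p d -> x != c -> d (branch p d x) = 1.
Proof.
move=> rT; have [k] := ubnP (d x); elim: k x => // k IHk x ltk xc.
have [dx | dx] := ltnP 1 (d x).
  rewrite (branch_parent rT dx); apply: IHk.
    by rewrite (rooted_depth rT xc) in ltk.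
  by move: dx; rewrite (depth_ge2 _ rT) => /andP[].
have := rooted_depth rT xc; move=> dxE; have dx1 : d x = 1 by lia.
by rewrite /branch dx1.
Qed.

(** With all vertices of depth at least two below the same child [y] of the root,
    moving the root to [y] brings them one step closer to it; the old root gets
    depth one and its other children depth two. *)
Lemma reroot c p d y : rooted c setT p d -> d y = 1 ->
    (forall x, 2 <= d x -> branch p d x = y) ->
  rooted y setT (upd p c y)
    (fun x => if x == c then 1 else if x == y then 0
              else if d x <= 1 then 2 else (d x).-1).
Proof.
move=> rT dy bry; have [_ dc _] := rT.
have yc : y != c by apply: contra_eqN dy => /eqP->; rewrite dc.
split; rewrite ?inE ?(negPf yc) ?eqxx // => x; rewrite !inE andbT => xy; split=> //.
have [-> | xc] := eqVneq x c; first by rewrite updE (negPf yc) eqxx.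
rewrite (negPf xy) updNE //; have dxE := rooted_depth rT xc.
have [dx | dx] := leqP (d x) 1; first by rewrite (depth_le1 rT) // eqxx.
have := dx; rewrite (depth_ge2 _ rT) => /andP[_ pxc]; rewrite (negPf pxc).
have [dpx | dpx] := leqP (d (p x)) 1.
  have dx2 : d x = 2 by lia.
  by have := bry x dx; rewrite /branch dx2 /= => ->; rewrite eqxx.
by case: eqP => [pxy | _]; [rewrite pxy dy in dpx | lia].
Qed.

Lemma reroot_edges c p d y : rooted c setT p d -> d y = 1 ->
  parent_edges c setT p = parent_edges y setT (upd p c y).
Proof.
move=> rT dy; have [_ dc _] := rT.
have yc : y != c by apply: contra_eqN dy => /eqP->; rewrite dc.
have py : p y = c by apply: (depth_le1 rT); rewrite ?dy.
apply/setP => e; apply/parent_edgesP/parent_edgesP => -[x]; rewrite !inE andbT.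
  move=> xc ->; have [-> | xy] := eqVneq x y.
    by exists c; rewrite ?inE ?updE ?py 1?eq_sym ?yc // setUC.
  by exists x; rewrite ?inE ?updNE ?xy.
move=> xy ->; have [-> | xc] := eqVneq x c.
  by exists y; rewrite ?inE ?updE ?py ?yc // setUC.
by exists x; rewrite ?inE ?updNE ?xc.
Qed.

(** A child of a deepest vertex of [P] would be a deeper vertex of [P]. *)
Lemma deepest_leaf c p d b (P : pred V) : rooted c setT p d -> P b -> 2 <= d b ->
    (forall x, P x -> d x <= d b) -> (forall x, 2 <= d x -> P (p x) -> P x) ->
  deep_leaf c p b.
Proof.
move=> rT Pb db bmax Pchild; have := db; rewrite (depth_ge2 _ rT) => /andP[bc pbc].
apply/deep_leafP; split=> // x xc; apply/eqP => pxb.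
have dx := rooted_depth rT xc; rewrite pxb in dx.
have Px : P x by apply: Pchild; rewrite ?pxb //; lia.
by have := bmax x Px; lia.
Qed.

End Branches.

(** * The face relation *)

Section Faces.
Variable n : nat.
Implicit Types (M N K : realignment n) (b v x : 'I_n) (A : {set 'I_n}).

Lemma realign_tree N : is_tree (tv N) (te N).
Proof. by case: N => d /= /and3P[]. Qed.

Lemma realign_card N : 1 < #|tv N|.
Proof. by case: N => d /= /and3P[]. Qed.

Lemma reattach_None N b : (ra N b == None) = (b \in tv N).
Proof.
case: N => d /= /and3P[_ _ /forallP/(_ b)].
by case: (ra d b) => [e|] // /andP[/negPf->].
Qed.

Lemma reattach_Some N b : b \notin tv N -> exists2 e, ra N b = Some e & e \in te N.
Proof.
case: N => d /= /and3P[_ _ /forallP/(_ b)].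
by case: (ra d b) => [e /andP[_ Ee] _| /negbF->] //; exists e.
Qed.

Lemma reattach_edge N b e : ra N b = Some e ->
  [/\ b \notin tv N, e \in te N, e \subset tv N & #|e| = 2].
Proof.
move=> rb; have nb : b \notin tv N by rewrite -reattach_None rb.
have [e' re' Ee'] := reattach_Some nb; rewrite re' in rb; case: rb Ee' => -> Ee.
by have /andP[-> /eqP] := tree_edge (realign_tree N) Ee.
Qed.

Lemma edge_sub N e : e \in te N -> e \subset tv N.
Proof. by move=> /(tree_edge (realign_tree N)) /andP[]. Qed.

Lemma realign_inj M N :
  tv M = tv N -> te M = te N -> (forall b, b \notin tv N -> ra M b = ra N b) -> M = N.
Proof.
move=> tvE teE raE; apply: val_inj.
rewrite [val M]surjective_pairing [(val M).1]surjective_pairing.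
rewrite [val N]surjective_pairing [(val N).1]surjective_pairing.
congr (_, _, _); [exact: tvE | exact: teE |].
apply/ffunP => b; have [bA | /raE //] := boolP (b \in tv N).
have /eqP := reattach_None M b; rewrite tvE bA => /eqP.
by move: bA; rewrite -reattach_None => /eqP-> /eqP.
Qed.

Definition in_edge (o : option {set 'I_n}) v := if o is Some e then v \in e else false.

(** [f] records where the labels of [B] that are specified between [N] and [M]
    get attached. *)
Definition face_by M N (f : 'I_n -> 'I_n) : Prop :=
  [/\ tv N \subset tv M,
      {in tv M :\: tv N, forall b, in_edge (ra N b) (f b)},
      te M = te N :|: [set [set f b; b] | b in tv M :\: tv N]
    & {in ~: tv M, ra M =1 ra N}].

Lemma specializesP N M :
  reflect (exists b v, in_edge (ra N b) v /\ val M = specify_data N b v) (specializes N M).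
Proof.
apply: (iffP existsP) => [[b /existsP[v /andP[bv /eqP]]] | [b [v [bv MN]]]].
  by exists b, v.
by exists b; apply/existsP; exists v; apply/andP; split; [exact: bv | apply/eqP].
Qed.

Lemma specialize_in N b v : in_edge (ra N b) v ->
  exists K, val K = specify_data N b v /\ specializes N K.
Proof.
move=> bv; case rb: (ra N b) (bv) => [e|] //= ve.
have KP := is_realignment_specify (valP N) rb ve.
by exists (Realignment KP); split=> //; apply/specializesP; exists b, v.
Qed.

(** Specifications at different labels do not interfere, so a face is a
    simultaneous choice of an end point of [r(b)] for some of the [b]. *)
Lemma face_leP M N : (M <= N)%O <-> exists f, face_by M N f.
Proof.
rewrite leEface; split.
  case/connectP=> p; elim: p N => [|K p IHp] N /=.
    move=> _ ->; exists id; rewrite /face_by setDv imset0 setU0; split=> //.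
    by move=> b; rewrite inE.
  case/andP=> /specializesP[b [v [bv KN]]] /IHp/[apply].
  have [tvK teK raK] : [/\ tv K = b |: tv N, te K = [set v; b] |: te N &
      forall x, ra K x = if x == b then None else ra N x].
    by rewrite /tv /te /ra KN; split=> //= x; rewrite ffunE.
  case=> f [tvM rf teM raM].
  have nb : b \notin tv N by rewrite -reattach_None; case: (ra N b) bv.
  have Mb : b \in tv M by apply: (subsetP tvM); rewrite tvK setU11.
  have tvD : tv M :\: tv N = b |: (tv M :\: tv K).
    apply/setP => x; rewrite tvK !inE; have [-> | xb] := eqVneq x b; first by rewrite nb.
    by [].
  exists (upd f b v); split.
  - by apply: subset_trans tvM; rewrite tvK subsetUr.
  - move=> x; rewrite tvD !inE /upd; have [-> // | xb] := eqVneq x b.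
    move=> /= xD; have := rf x; rewrite inE xD => /(_ isT).
    by rewrite raK (negPf xb).
  - rewrite teM teK tvD imsetU1 {1}/upd eqxx setUCA setUA; congr (_ :|: _).
    apply: eq_in_imset => x; rewrite tvK !inE /upd.
    by case: eqP.
  move=> x; rewrite inE => xM; rewrite raM ?inE // raK; case: eqP => // xb.
  by rewrite -xb (negPf xM) in Mb.
case=> f; have [k] := ubnP #|tv M :\: tv N|; elim: k N => // k IHk N ltk [tvM rf teM raM].
have [D0 | [b bD]] := set_0Vmem (tv M :\: tv N).
  have tvE : tv M = tv N by apply/eqP; rewrite eqEsubset tvM -setD_eq0 D0 eqxx.
  have -> : M = N; last exact: connect0.
  apply: realign_inj => // [|b]; first by rewrite teM D0 imset0 setU0.
  by rewrite -tvE => bM; rewrite raM ?inE.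
have [K [KN specK]] := specialize_in (rf b bD).
have [tvK teK raK] : [/\ tv K = b |: tv N, te K = [set f b; b] |: te N &
    forall x, ra K x = if x == b then None else ra N x].
  by rewrite /tv /te /ra KN; split=> //= x; rewrite ffunE.
have tvD : tv M :\: tv K = (tv M :\: tv N) :\ b by rewrite tvK setUC setDDl.
apply: connect_trans (connect1 specK) _; apply: IHk.
  by rewrite tvD; move: ltk; rewrite (cardsD1 b) bD; lia.
have /setDP[Mb nb] := bD; split.
- by rewrite tvK subUset sub1set Mb.
- by move=> x; rewrite tvD raK in_setD1 => /andP[/negPf-> /rf].
- rewrite teM teK tvD -{1}(setD1K bD) imsetU1 setUCA.
  by rewrite -setUA.
move=> x xM; rewrite raM // raK; case: eqP xM => // ->.
by rewrite inE Mb.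
Qed.

End Faces.

Section FaceConsequences.
Variable n : nat.
Implicit Types (M N K T : realignment n) (b v x : 'I_n) (A : {set 'I_n}).

Lemma le_verts M N : (M <= N)%O -> tv N \subset tv M.
Proof. by case/face_leP=> f []. Qed.

Lemma le_reattach M N b : (M <= N)%O -> b \notin tv M -> ra M b = ra N b.
Proof. by case/face_leP=> f [_ _ _ raM] nb; rewrite raM ?inE. Qed.

Lemma le_edgesE M N e : (M <= N)%O ->
  (e \in te N) = (e \in te M) && (e \subset tv N).
Proof.
case/face_leP=> f [tvM rf teM raM]; rewrite teM inE.
have [eN | neN] /= := boolP (e \in te N); first by rewrite edge_sub.
apply/esym/negbTE; apply/negP => /andP[/imsetP[b /setDP[_ nb] ->]].
by rewrite subUset !sub1set (negPf nb) andbF.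
Qed.

(** A cube induces on its tree vertices the edges of any of its faces, and keeps
    the sliding edges of the labels that still slide in the face. So two faces
    determine the cube if each of its sliding labels slides in one of them. *)
Lemma eq_of_two_faces M1 M2 N K :
    (M1 <= N)%O -> (M2 <= N)%O -> (M1 <= K)%O -> (M2 <= K)%O ->
    tv M1 :&: tv M2 \subset tv N -> #|tv N| = #|tv K| -> N = K.
Proof.
move=> M1N M2N M1K M2K subN cardNK.
have tvE : tv K = tv N.
  apply/eqP; rewrite eqEcard cardNK leqnn andbT (subset_trans _ subN) //.
  by rewrite subsetI !le_verts.
apply: realign_inj => // [|b].
  by apply/setP => e; rewrite (le_edgesE _ M1N) (le_edgesE _ M1K) tvE.
rewrite tvE => nb; have := contra (subsetP subN b) nb.
rewrite inE negb_and => /orP[] nbM.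
  by rewrite -(le_reattach M1N) // (le_reattach M1K).
by rewrite -(le_reattach M2N) // (le_reattach M2K).
Qed.

Lemma eq_set2_mem (T : finType) (e : {set T}) (x y : T) :
  #|e| = 2 -> x \in e -> y \in e -> x != y -> e = [set x; y].
Proof.
move=> e2 xe ye xy; apply/eqP; rewrite eq_sym eqEcard subUset !sub1set xe ye.
by rewrite e2 cards2 xy.
Qed.

Lemma in_edgeE N b v : in_edge (ra N b) v ->
  exists e, [/\ ra N b = Some e, v \in e, b \notin tv N, v \in tv N & #|e| = 2].
Proof.
case rb: (ra N b) => [e|] //= ve; have [nb _ eN e2] := reattach_edge rb.
by exists e; split=> //; apply: (subsetP eN).
Qed.

Lemma vertex_of_edge M T b : (T <= M)%O -> tv T = setT -> tv M = [set~ b] ->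
  exists2 v, in_edge (ra M b) v & te T = [set v; b] |: te M.
Proof.
case/face_leP=> f [_ rf teT _] TT Mb; exists (f b).
  by apply: rf; rewrite TT Mb !inE eqxx.
by rewrite teT TT Mb setTD setCK imset_set1 setUC.
Qed.

(** The two trees differ in one edge each, and these edges meet in the label that
    slides; their other ends span the edge along which it slides. *)
Lemma edge_unique M M' T0 T1 :
    #|tv M|.+1 = n -> #|tv M'|.+1 = n -> tv T0 = setT -> tv T1 = setT -> T0 != T1 ->
    (T0 <= M)%O -> (T1 <= M)%O -> (T0 <= M')%O -> (T1 <= M')%O -> M = M'.
Proof.
have compl1 N : #|tv N|.+1 = n -> exists b, tv N = [set~ b].
  move=> cN; have /cards1P[b nb] : #|~: tv N| == 1.
    by rewrite cardsCs setCK card_ord -[X in X - _]cN subSnn.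
  by exists b; rewrite -nb setCK.
move=> /compl1[b Mb] /compl1[b' Mb'] TT0 TT1 T01 T0M T1M T0M' T1M'.
have eqT : te T0 = te T1 -> T0 = T1.
  by move=> teE; apply: realign_inj; rewrite ?TT0 ?TT1 // => x; rewrite inE.
have [v0 bv0 teT0] := vertex_of_edge T0M TT0 Mb.
have [v1 bv1 teT1] := vertex_of_edge T1M TT1 Mb.
have [w0 bw0 teT0'] := vertex_of_edge T0M' TT0 Mb'.
have [w1 bw1 teT1'] := vertex_of_edge T1M' TT1 Mb'.
have v01 : v0 != v1 by apply: contraNneq T01 => v01; rewrite eqT // teT0 teT1 v01.
have nM e v : e = [set v; b] -> e \notin te M.
  by move=> ->; apply/negP => /edge_sub; rewrite Mb subUset !sub1set !inE eqxx andbF.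
have [e [rb v0e _ _ e2]] := in_edgeE bv0; rewrite rb /= in bv1.
(* Each tree has an edge at [b] that the other one lacks; as the trees also differ
   only at the label [b'] sliding in [M'], these edges both contain [b']. *)
have in1 : [set v0; b] \notin te T1.
  rewrite teT1 inE (negPf (nM _ v0 erefl)) orbF inE.
  by apply: contra v01; rewrite setUC [X in _ == X]setUC => /eqP/set2_inj_r->.
have in0 : [set v1; b] \notin te T0.
  rewrite teT0 inE (negPf (nM _ v1 erefl)) orbF inE.
  by apply: contra v01; rewrite setUC [X in _ == X]setUC => /eqP/set2_inj_r->.
have eq0 : [set v0; b] = [set w0; b'].
  apply/eqP; have : [set v0; b] \in te T0 by rewrite teT0 setU11.
  rewrite teT0' !inE => /orP[] // h; case/negP: in1.
  by rewrite teT1' inE h orbT.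
have eq1 : [set v1; b] = [set w1; b'].
  apply/eqP; have : [set v1; b] \in te T1 by rewrite teT1 setU11.
  rewrite teT1' !inE => /orP[] // h; case/negP: in0.
  by rewrite teT0' inE h orbT.
have bb' : b' = b.
  have : b' \in [set v0; b] by rewrite eq0 !inE eqxx orbT.
  have : b' \in [set v1; b] by rewrite eq1 !inE eqxx orbT.
  rewrite !inE => /orP[/eqP v1E|/eqP//] /orP[/eqP v0E|/eqP//].
  by rewrite -v1E -v0E eqxx in v01.
rewrite {}bb' in Mb' bw0 bw1 eq0 eq1 *.
have v0w : v0 = w0 by move: eq0; rewrite setUC [RHS]setUC => /set2_inj_r.
have v1w : v1 = w1 by move: eq1; rewrite setUC [RHS]setUC => /set2_inj_r.
rewrite -{}v0w -{}v1w in bw0 bw1.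
apply: realign_inj; first by rewrite Mb.
  by apply/setP => f; rewrite (le_edgesE _ T0M) (le_edgesE _ T0M') Mb Mb'.
move=> x; rewrite Mb' !inE negbK => /eqP->.
have [e' [rb' v0e' _ _ e2']] := in_edgeE bw0; rewrite rb' /= in bw1.
by rewrite rb rb' (eq_set2_mem e2 v0e bv1 v01) (eq_set2_mem e2' v0e' bw1 v01).
Qed.

End FaceConsequences.

(** * Cubes described by a parent function *)

Section RootedCells.
Variable n : nat.
Implicit Types (M N K T : realignment n) (c b v x : 'I_n) (A : {set 'I_n}).
Implicit Types (p g : 'I_n -> 'I_n) (d : 'I_n -> nat).

(** The cube with tree [A], rooted at [c] with parents [p], where each label [b]
    outside [A] slides along the edge [{p b, g b}]. Taking the parent [p b] as
    one of the two ends makes the same function [p] describe both a cube and one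
    of its vertices. *)
Definition cell_data c A p g : realign_data n :=
  (A, parent_edges c A p, [ffun b => if b \in A then None else Some [set p b; g b]]).

Lemma is_realignment_cell c A p g d : rooted c A p d -> 1 < #|A| ->
  {in ~: A, forall b, [set p b; g b] \in parent_edges c A p} ->
  is_realignment (cell_data c A p g).
Proof.
move=> rA A2 gP; apply/and3P; split=> //; first exact: rooted_tree rA.
apply/forallP => b; rewrite /ra /= ffunE; case: ifPn => // nb.
by rewrite gP ?inE ?nb.
Qed.

Lemma eq_cell_data c A p g p' g' : {in A :\ c, p =1 p'} ->
  {in ~: A, forall b, [set p b; g b] = [set p' b; g' b]} ->
  cell_data c A p g = cell_data c A p' g'.
Proof.
move=> pp' gg'; congr (_, _, _).
  by apply: eq_in_imset => x xA; rewrite pp'.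
by apply/ffunP => b; rewrite !ffunE; case: ifPn => // nb; rewrite gg' ?inE.
Qed.

Lemma parent_edgesU c A A' p : c \in A -> A \subset A' ->
  parent_edges c A' p = parent_edges c A p :|: [set [set p x; x] | x in A' :\: A].
Proof.
move=> Ac AA'; rewrite /parent_edges -imsetU; congr (imset _ (mem (_ : {set 'I_n}))).
apply/setP => x; rewrite !inE; have [-> | xc] := eqVneq x c; first by rewrite Ac.
by have [/(subsetP AA')-> | _] := boolP (x \in A); rewrite ?orbT.
Qed.

Lemma le_cell M N c A p g A' p' g' :
    val M = cell_data c A' p' g' -> val N = cell_data c A p g ->
    c \in A -> A \subset A' -> {in A :\ c, p' =1 p} ->
    {in A' :\: A, forall b, p' b \in [set p b; g b]} ->
    {in ~: A', forall b, [set p' b; g' b] = [set p b; g b]} ->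
  (M <= N)%O.
Proof.
move=> ME NE Ac AA' pp' p'g gg'; apply/face_leP; exists p'.
rewrite /face_by /tv /te /ra ME NE /=; split=> //.
- move=> b bD; rewrite ffunE; have := bD; rewrite inE => /andP[/negPf-> _].
  exact: p'g.
- rewrite (parent_edgesU _ Ac AA'); congr (_ :|: _).
  by apply: eq_in_imset => x xA; rewrite pp'.
move=> b bA'; have nA' := bA'; rewrite inE in nA'.
rewrite !ffunE (negPf nA') (negPf (contra (subsetP AA' b) nA')).
by rewrite gg'.
Qed.

(** On the labels that keep sliding, [f] may be taken equal to [p]; then [g]
    need not change. *)
Lemma face_of_cell M N c A p g : val N = cell_data c A p g -> c \in A -> (M <= N)%O ->
  exists f, [/\ A \subset tv M, val M = cell_data c (tv M) f g, {in A, f =1 p},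
      {in tv M :\: A, forall b, f b \in [set p b; g b]} & {in ~: tv M, f =1 p}].
Proof.
move=> NE Ac /face_leP[f [tvM rf teM raM]].
have tvN : tv N = A by rewrite /tv NE.
have teN : te N = parent_edges c A p by rewrite /te NE.
have raN b : ra N b = if b \in A then None else Some [set p b; g b].
  by rewrite /ra NE ffunE.
rewrite tvN in tvM rf teM.
exists (fun b => if b \in tv M :\: A then f b else p b); split=> //.
- rewrite [val M]surjective_pairing [(val M).1]surjective_pairing.
  congr (_, _, _); first rewrite -[LHS]/(te M).
    rewrite teM (parent_edgesU _ Ac tvM) teN; congr (_ :|: _).
      by apply: eq_in_imset => x; rewrite !inE => /andP[_ ->].
    by apply: eq_in_imset => x ->.
  apply/ffunP => b; rewrite ffunE -/(ra M b); case: ifPn => [|nb].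
    by rewrite -reattach_None => /eqP.
  rewrite raM ?inE // raN (negPf (contra (subsetP tvM b) nb)).
  by rewrite (negPf nb) andbF.
- by move=> b bA; rewrite inE bA.
- by move=> b bD; rewrite bD; have := rf b bD; rewrite raN; move: bD; rewrite inE => /andP[/negPf->].
by move=> b; rewrite !inE => /negPf->; rewrite andbF.
Qed.

Lemma vertex_of_cell T N c A p g :
    val N = cell_data c A p g -> c \in A -> (T <= N)%O -> tv T = setT ->
  exists f, [/\ val T = cell_data c setT f id, {in A, f =1 p}
              & {in ~: A, forall b, f b \in [set p b; g b]}].
Proof.
move=> NE Ac TN TT; have [f [_ TE fp fg _]] := face_of_cell NE Ac TN.
exists f; split=> // [|b nb]; last by apply: fg; rewrite TT setTD.
by rewrite TE TT; apply: eq_cell_data => // b; rewrite !inE.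
Qed.

Lemma vertex_cell T c : tv T = setT ->
  exists p d, rooted c setT p d /\ val T = cell_data c setT p id.
Proof.
move=> TT; have [||p [d [rT ET]]] := @tree_rooted _ setT (te T) c.
- by rewrite -TT; apply: realign_tree.
- by rewrite inE.
exists p, d; split=> //; rewrite [val T]surjective_pairing [(val T).1]surjective_pairing.
congr (_, _, _) => //; apply/ffunP => b; rewrite ffunE inE -/(ra T b).
by apply/eqP; rewrite reattach_None TT inE.
Qed.

End RootedCells.

(** * Stars and the cubes around them *)

Section Stars.
Variable n : nat.
Implicit Types (M N K T S Q : realignment n) (c b u v w x : 'I_n) (A : {set 'I_n}).
Implicit Types (p g : 'I_n -> 'I_n).

Lemma ord_avoid (s : seq 'I_n) : size s < n -> exists x, x \notin s.
Proof.
move=> ltsn; apply/existsP; apply: contraTT ltsn => /existsPn all_s.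
rewrite -leqNgt -[X in X <= _]card_ord (leq_trans _ (card_size s)) //.
by apply/subset_leq_card/subsetP => x _; apply: negbNE; apply: all_s.
Qed.

Definition star_data u := cell_data u setT (fun=> u) id.
(** The cube of dimension [n - 2] on the edge [{u, v}]. *)
Definition top_data u v := cell_data u [set u; v] (fun=> u) (fun=> v).
(** The edge of the complex leaving the star at [u] by sliding the leaf [b] to
    [v]. *)
Definition slide_data u v b := cell_data u [set~ b] (fun=> u) (fun=> v).

(** These are all the cubes around the star at [u]: its edges towards the labels
    of [A] stay, and every other label [b] slides along the edge to [g b]. *)
Lemma spoke_cell u A g : u \in A -> 1 < #|A| ->
  {in ~: A, forall b, g b \in A :\ u} ->
  exists N, val N = cell_data u A (fun=> u) g.
Proof.
move=> Au A2 gA.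
have NP : is_realignment (cell_data u A (fun=> u) g).
  apply: (@is_realignment_cell _ _ _ _ _ (fun x => x != u)) => //.
    split=> // [|x]; first by rewrite eqxx.
    by rewrite !inE Au eqxx => /andP[->].
  by move=> b /gA; rewrite !inE => /andP[gu gbA]; apply: mem_parent_edges.
by exists (Realignment NP).
Qed.

Lemma star_exists u : 1 < n -> exists S, val S = star_data u.
Proof.
move=> n2; apply: spoke_cell; rewrite ?inE ?cardsT ?card_ord //.
by move=> b; rewrite !inE.
Qed.

Lemma top_exists u v : u != v -> exists Q, val Q = top_data u v.
Proof.
move=> uv; apply: spoke_cell; rewrite ?cards2 ?uv ?inE ?eqxx //.
by move=> b _; rewrite orbT eq_sym uv.
Qed.

Lemma slide_exists u v b : u != v -> u != b -> v != b ->
  exists M, val M = slide_data u v b.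
Proof.
move=> uv ub vb; apply: spoke_cell; first by rewrite !inE.
  apply: (@leq_trans #|[set u; v]|); first by rewrite cards2 uv.
  by apply/subset_leq_card; rewrite subUset !sub1set !inE ub.
by move=> c _; rewrite !inE vb eq_sym uv.
Qed.

(** The tree has a single edge, so every other label slides along it. *)
Lemma top_of_verts N u v : u != v -> tv N = [set u; v] -> val N = top_data u v.
Proof.
move=> uv Nuv; have c2 : #|[set u; v]| = 2 by rewrite cards2 uv.
have eN e : e \in te N -> e = [set u; v].
  move=> /(tree_edge (realign_tree N)) /andP[eN /eqP e2].
  by apply/eqP; rewrite eqEcard c2 e2 -Nuv eN.
have uN : u \in tv N by rewrite Nuv !inE eqxx.
have [p [d [[_ _ dS] teN]]] := tree_rooted (realign_tree N) uN.
have euv : [set u; v] \in te N.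
  have vN : v \in tv N by rewrite Nuv !inE eqxx orbT.
  have e0 : [set p v; v] \in te N by rewrite teN mem_parent_edges // eq_sym.
  by rewrite -(eN _ e0).
rewrite [val N]surjective_pairing [(val N).1]surjective_pairing.
congr (_, _, _) => //.
  apply/setP => e; rewrite -/(te N); apply/idP/parent_edgesP => [/eN -> | [x + ->]].
    by exists v; rewrite // !inE eqxx orbT eq_sym uv.
  by rewrite !inE; case: eqP => //= _ /eqP->.
apply/ffunP => b; rewrite ffunE -/(ra N b) -Nuv -reattach_None.
by case rb: (ra N b) => [e|] //=; have [_ /eN-> _ _] := reattach_edge rb; rewrite Nuv.
Qed.

Lemma top_cases Q : #|tv Q| = 2 -> exists u v,
  [/\ u != v, tv Q = [set u; v] & val Q = top_data u v].
Proof.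
move/eqP/cards2P=> [u [v [uv Quv]]]; exists u, v.
by split=> //; apply: top_of_verts.
Qed.

Lemma star_le_top S Q u v : val S = star_data u -> val Q = top_data u v -> (S <= Q)%O.
Proof.
move=> SE QE; apply: (le_cell SE QE); first by rewrite !inE eqxx.
- exact: subsetT.
- by [].
- by move=> b _; rewrite !inE eqxx.
by move=> b; rewrite !inE.
Qed.

Lemma star_edges S u e : val S = star_data u -> e \in te S -> u \in e.
Proof. by rewrite /te => -> /imsetP[x _ ->]; rewrite !inE eqxx. Qed.

Lemma star_data_inj u w : 2 < n -> star_data u = star_data w -> u = w.
Proof.
move=> n3 uw; have [x] := @ord_avoid [:: u; w] n3.
rewrite !inE negb_or => /andP[xu xw].
have : [set u; x] \in (star_data u).1.2 by apply: (@mem_parent_edges _ u setT (fun=> u) x); rewrite ?inE.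
rewrite uw => /imsetP[z _] uxz; have : w \in [set u; x] by rewrite uxz !inE eqxx.
by rewrite !inE => /orP[/eqP->// | /eqP wx]; rewrite wx eqxx in xw.
Qed.

(** All edges of a tree in a top cube meet the edge of that cube. Two distinct
    such edges share a vertex [u], as both belong to the tree and meet. With
    [{u, v}] and [{u, y}] these edges, an edge of the tree avoiding [u] could
    only be [{v, y}], but [y] is a leaf, attached to [u]. *)
Lemma vertex_in_two_tops T N N' : tv T = setT -> #|tv N| = 2 -> #|tv N'| = 2 ->
  N != N' -> (T <= N)%O -> (T <= N')%O -> exists u, val T = star_data u.
Proof.
move=> TT N2 N'2 NN' TN TN'.
(* Trees with one edge and the same two vertices give the same top cube, so the
   vertices differ. *)
have [v vN vN'] : exists2 v, v \in tv N & v \notin tv N'.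
  apply/subsetPn; apply: contra NN' => sNN'.
  have tvE : tv N = tv N' by apply/eqP; rewrite eqEcard sNN' N2 N'2.
  have [u [w [uw Nuw NE]]] := top_cases N2.
  apply/eqP/val_inj; rewrite NE; apply/esym/top_of_verts => //.
  by rewrite -tvE.
have [u [uv Nuv]] : exists u, u != v /\ tv N = [set u; v].
  have [x [y [xy Nxy _]]] := top_cases N2; move: vN; rewrite Nxy !inE.
  case/orP=> /eqP->; last by exists x.
  by exists y; rewrite eq_sym setUC.
have NE := top_of_verts uv Nuv.
have meetN' e : e \in te T -> exists2 x, x \in e & x \in tv N'.
  have [x [y [xy N'xy N'E]]] := top_cases N'2.
  have [|f [TE fx fxy]] := vertex_of_cell N'E _ TN' TT; first by rewrite !inE eqxx.
  rewrite /te TE => /imsetP[z _ ->]; have [zN' | zN'] := boolP (z \in tv N').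
    by exists z; rewrite // !inE eqxx orbT.
  exists (f z); first by rewrite !inE eqxx.
  by rewrite N'xy; apply: fxy; rewrite -N'xy inE.
have uN' : u \in tv N'.
  have euv : [set u; v] \in te T.
    have : [set u; v] \in te N.
      by rewrite /te NE; apply/parent_edgesP; exists v; rewrite // !inE eqxx orbT eq_sym uv.
    by rewrite (le_edgesE _ TN) => /andP[].
  by have [x + xN'] := meetN' _ euv; rewrite !inE => /orP[/eqP<- // | /eqP xE]; rewrite -xE xN' in vN'.
have [y [uy N'uy]] : exists y, u != y /\ tv N' = [set u; y].
  have [x [y [xy Nxy _]]] := top_cases N'2; move: uN'; rewrite Nxy !inE.
  case/orP=> /eqP->; first by exists y.
  by exists x; rewrite eq_sym setUC.
have N'E := top_of_verts uy N'uy.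
have [|f [TE fu fuv]] := vertex_of_cell NE _ TN TT; first by rewrite !inE eqxx.
have fy : f y = u.
  have : [set u; y] \in te N'.
    by rewrite /te N'E; apply/parent_edgesP; exists y; rewrite // !inE eqxx orbT eq_sym uy.
  rewrite (le_edgesE _ TN') => /andP[+ _].
  rewrite /te TE => /parent_edgesP[z]; rewrite !inE andbT => zu uyz.
  have : u \in [set f z; z] by rewrite -uyz !inE eqxx.
  have : z \in [set u; y] by rewrite uyz !inE eqxx orbT.
  by rewrite !inE (negPf zu) /= => /eqP-> /orP[/eqP|/eqP uE] //; rewrite uE eqxx in uy.
exists u; rewrite TE; apply: eq_cell_data => [b|b]; rewrite !inE ?andbT // => bu.
have [buv | buv] := boolP (b \in [set u; v]); first exact: fu.
have := fuv b; rewrite !inE => /(_ _)/orP[|/eqP//|/eqP fb].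
  by move: buv; rewrite !inE.
have : [set f b; b] \in te T by rewrite /te TE; apply: mem_parent_edges; rewrite ?inE.
case/meetN' => x; rewrite N'uy !inE fb => /orP[] /eqP-> /orP[] /eqP xE.
- by rewrite xE eqxx in uv.
- by move: vN'; rewrite N'uy xE !inE eqxx orbT.
- by rewrite xE eqxx in bu.
by rewrite -fb xE fy.
Qed.

(** In an edge of the top cube on [{u, v}] that contains the star at [u], all
    labels but one have chosen [u]. *)
Lemma slide_cases M S Q u v : u != v -> #|tv M|.+1 = n ->
    val S = star_data u -> val Q = top_data u v -> (S <= M)%O -> (M <= Q)%O ->
  exists b, [/\ u != b, v != b & val M = slide_data u v b].
Proof.
move=> uv cM SE QE SM MQ.
have /cards1P[b nb] : #|~: tv M| == 1.
  by rewrite cardsCs setCK card_ord -[X in X - _]cM subSnn.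
have Mb : tv M = [set~ b] by rewrite -nb setCK.
have [|f [sM ME fu fuv fM]] := face_of_cell QE _ MQ; first by rewrite !inE eqxx.
have : [set u; v] \subset [set~ b] by rewrite -Mb.
rewrite subUset !sub1set !inE => /andP[ub vb].
exists b; split=> //; rewrite ME /slide_data -Mb; apply: eq_cell_data => // x.
  rewrite !inE => /andP[xu xM].
  have : [set f x; x] \in te M by rewrite /te ME; apply: mem_parent_edges.
  rewrite (le_edgesE _ SM) => /andP[/(star_edges SE) + _].
  by rewrite !inE [u == x]eq_sym (negPf xu) orbF => /eqP.
by move=> /fM ->.
Qed.

Lemma slide_dim M u v b : val M = slide_data u v b -> #|tv M|.+1 = n.
Proof.
move=> ME; rewrite /tv ME /= cardsCs setCK cards1 card_ord.
by have := ltn_ord b; lia.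
Qed.

Lemma star_le_slide S M u v b : u != b ->
  val S = star_data u -> val M = slide_data u v b -> (S <= M)%O.
Proof.
move=> ub SE ME; apply: (le_cell SE ME); first by rewrite !inE.
- exact: subsetT.
- by [].
- by move=> x _; rewrite !inE eqxx.
by move=> x; rewrite !inE.
Qed.

Lemma slide_le_top M Q u v b : u != b -> v != b ->
  val M = slide_data u v b -> val Q = top_data u v -> (M <= Q)%O.
Proof.
move=> ub vb ME QE; apply: (le_cell ME QE); first by rewrite !inE eqxx.
- by rewrite subUset !sub1set !inE ub.
- by [].
- by move=> x _; rewrite !inE eqxx.
by [].
Qed.

(** Five distinct labels are involved: this is where five labels are required. *)
Lemma slides_bounded u v v' b b' : uniq [:: u; v; v'; b; b'] ->
  exists N, forall M M', val M = slide_data u v b -> val M' = slide_data u v' b' ->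
    (M <= N)%O /\ (M' <= N)%O.
Proof.
rewrite /= !inE !negb_or andbT => /and4P[/and4P[uv uv' ub ub'] /and3P[vv' vb vb'] /andP[v'b v'b'] bb'].
have inA x : (x \in ~: [set b; b']) = (x != b) && (x != b').
  by rewrite !inE negb_or.
have [||| N NE] := @spoke_cell u (~: [set b; b']) (fun x => if x == b then v else v').
- by rewrite inA ub.
- apply: (@leq_trans #|[set u; v]|); first by rewrite cards2 uv.
  by apply/subset_leq_card; rewrite subUset !sub1set !inA ub ub' vb vb'.
- move=> x _; rewrite in_setD1 inA; case: ifP => _.
    by rewrite eq_sym uv vb.
  by rewrite eq_sym uv' v'b.
exists N => M M' ME ME'; split.
  apply: (le_cell ME NE); first by rewrite inA ub.
  - by apply/subsetP => x; rewrite inA !inE => /andP[].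
  - by [].
  - by move=> x _; rewrite !inE eqxx.
  by move=> x; rewrite !inE negbK => ->.
apply: (le_cell ME' NE); first by rewrite inA ub.
- by apply/subsetP => x; rewrite inA !inE => /andP[].
- by [].
- by move=> x _; rewrite !inE eqxx.
by move=> x; rewrite !inE negbK => /eqP->; rewrite [b' == b]eq_sym (negPf bb').
Qed.

(** A label that slides cannot be an end point of an edge along which another
    label slides. *)
Lemma slides_unbounded u v v' b' M M' N : u != v' -> v' != b' ->
  val M = slide_data u v v' -> val M' = slide_data u v' b' ->
  (M <= N)%O -> (M' <= N)%O -> False.
Proof.
move=> uv' v'b' ME ME' MN M'N.
have nv : v' \notin tv N.
  by apply: contra (subsetP (le_verts MN) v') _; rewrite /tv ME !inE eqxx.
have nb' : b' \notin tv M' by rewrite /tv ME' !inE eqxx.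
have rb : ra N b' = Some [set u; v'].
  by rewrite -(le_reattach M'N nb') /ra ME' ffunE !inE eqxx.
have [_ _ /subsetP/(_ v') + _] := reattach_edge rb.
by rewrite !inE eqxx orbT (negPf nv) => /(_ isT).
Qed.

End Stars.

Section Automorphisms.
Variable n : nat.
Implicit Types (M N K T S Q : realignment n) (phi : {perm realignment n}).

Lemma aut_mono phi M N : phi \in AutX n -> (phi M <= phi N)%O = (M <= N)%O.
Proof. by move/poset_autP. Qed.

(** A specification adds one tree vertex, and the image of a specification adds at
    least one. Starting from the vertices of the complex, whose trees contain all
    labels, it follows that an image has at most as many tree vertices as the
    original; the inverse automorphism gives the other inequality. *)
Lemma aut_card phi N : phi \in AutX n -> #|tv (phi N)| = #|tv N|.
Proof.
have le_card psi M : psi \in AutX n -> #|tv (psi M)| <= #|tv M|.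
  move=> Apsi; have [k] := ubnP (n - #|tv M|); elim: k M => // k IHk M ltk.
  have [MT | [b]] := set_0Vmem (~: tv M).
    by rewrite -(setCK (tv M)) MT setC0 cardsT max_card.
  rewrite inE => nb; have [e rb _] := reattach_Some nb.
  have [_ _ _ /eqP/cards2P[v [w [_ eE]]]] := reattach_edge rb.
  have [|K [KE MK]] := @specialize_in _ M b v; first by rewrite rb /= eE !inE eqxx.
  have cK : #|tv K| = #|tv M|.+1 by rewrite /tv KE /= cardsU1 nb.
  have leKM : (psi K <= psi M)%O by rewrite aut_mono //; apply: connect1.
  have ltc : #|tv (psi M)| < #|tv (psi K)|.
    apply: face_le_card leKM _; rewrite (inj_eq perm_inj).
    by apply: contra_eqN cK => /eqP->; rewrite neq_ltn ltnSn.
  rewrite -ltnS -cK (leq_trans ltc) //; apply: IHk.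
  have : #|tv K| <= n by rewrite -[X in _ <= X]card_ord max_card.
  by lia.
move=> Aphi; apply/eqP; rewrite eqn_leq le_card //=.
by have := le_card phi^-1%g (phi N); rewrite permK groupV; apply.
Qed.

Lemma vertexE N : (tv N == setT) = (#|tv N| == n).
Proof.
by rewrite eqEcard subsetT cardsT card_ord eqn_leq (leq_trans (max_card _)) ?card_ord.
Qed.

Lemma aut_vertex phi N : phi \in AutX n -> tv N = setT -> tv (phi N) = setT.
Proof. by move=> Aphi /eqP NT; apply/eqP; move: NT; rewrite !vertexE aut_card. Qed.

Lemma aut_star phi S u : 2 < n -> phi \in AutX n -> val S = star_data u ->
  exists w, val (phi S) = star_data w.
Proof.
move=> n3 Aphi SE.
have [v] := @ord_avoid n [:: u] (ltnW n3); rewrite inE eq_sym => uv.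
have [w] := @ord_avoid n [:: u; v] n3; rewrite !inE negb_or => /andP[wu wv].
have [Q QE] := top_exists uv; rewrite eq_sym in wu; have [Q' QE'] := top_exists wu.
have QQ' : Q != Q'.
  apply: contraNneq wv => QQ'; have : w \in tv Q' by rewrite /tv QE' !inE eqxx orbT.
  by rewrite -QQ' /tv QE !inE [w == u]eq_sym (negPf wu).
apply: (@vertex_in_two_tops _ _ (phi Q) (phi Q')).
- by apply: aut_vertex => //; rewrite /tv SE.
- by rewrite aut_card // /tv QE cards2 uv.
- by rewrite aut_card // /tv QE' cards2 wu.
- by rewrite (inj_eq perm_inj).
- by rewrite aut_mono // (star_le_top SE QE).
by rewrite aut_mono // (star_le_top SE QE').
Qed.

End Automorphisms.

(** * Automorphisms fixing every star *)

Section FixedTrees.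
Variables (n : nat) (phi : {perm realignment n}).
Hypotheses (hn : 5 <= n) (Aphi : phi \in AutX n).
Hypothesis fix_star : forall u S, val S = star_data u -> phi S = S.
Implicit Types (M N K T S Q : realignment n) (c b u v w x : 'I_n) (A : {set 'I_n}).
Implicit Types (p g : 'I_n -> 'I_n) (d : 'I_n -> nat).

(** Only the top cube on [{u, v}] contains both the star at [u] and that at
    [v]. *)
Lemma fix_top Q u v : u != v -> val Q = top_data u v -> phi Q = Q.
Proof.
move=> uv QE; have n2 : 1 < n by lia.
have [S SE] := star_exists u n2; have [S' SE'] := star_exists v n2.
have QE' : val Q = top_data v u.
  by apply: top_of_verts; rewrite 1?eq_sym // setUC /tv QE.
have [x [y [xy Qxy QxyE]]] : exists x y, [/\ x != y, tv (phi Q) = [set x; y] & val (phi Q) = top_data x y].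
  by apply: top_cases; rewrite aut_card // /tv QE cards2 uv.
have xyQ : [set x; y] \in te (phi Q).
  by rewrite /te QxyE; apply/parent_edgesP; exists y; rewrite // !inE eqxx orbT eq_sym xy.
have in_xy w (R : realignment n) : val R = star_data w -> (R <= Q)%O -> w \in [set x; y].
  move=> RE RQ; move: xyQ; rewrite -(aut_mono _ _ Aphi) in RQ.
  by rewrite (le_edgesE _ RQ) (fix_star RE) => /andP[/(star_edges RE)].
have uQ := in_xy _ _ SE (star_le_top SE QE).
have vQ := in_xy _ _ SE' (star_le_top SE' QE').
apply/val_inj; rewrite QE; apply: top_of_verts => //.
by rewrite Qxy; apply: eq_set2_mem; rewrite ?cards2 ?xy.
Qed.

(** The image slides some [b2] to [v]. If [b2] were not [b], it would lie in a
    common cube with an edge sliding some [b'] to [b], and so would [M] with an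
    edge of the same kind, against [slides_unbounded]. *)
Lemma fix_slide M u v b : u != v -> u != b -> v != b ->
  val M = slide_data u v b -> phi M = M.
Proof.
move=> uv ub vb ME; have n2 : 1 < n by lia.
have [S SE] := star_exists u n2; have [Q QE] := top_exists uv.
have [|||b2 [ub2 vb2 phiME]] := @slide_cases _ (phi M) S Q u v uv _ SE QE.
- by rewrite aut_card // (slide_dim ME).
- by rewrite -(fix_star SE) aut_mono // (star_le_slide ub SE ME).
- by rewrite -(fix_top uv QE) aut_mono // (slide_le_top ub vb ME QE).
have [bE | bb2] := eqVneq b b2; first by apply: val_inj; rewrite ME bE.
(* [b] now plays the part of the second class: [M] slides it, and the image of [M]
   does not. *)
have [b'] := @ord_avoid n [:: u; v; b; b2] hn.
rewrite !inE !negb_or => /and4P[b'u b'v b'b b'b2].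
have bb' : b != b' by rewrite eq_sym.
have ub' : u != b' by rewrite eq_sym.
have [M' M'E] := slide_exists ub ub' bb'.
have [|N /(_ _ _ phiME M'E)[MN M'N]] := @slides_bounded n u v b b2 b'.
  by rewrite /= !inE !negb_or uv ub ub2 ub' vb vb2 bb2 bb' ![_ == b']eq_sym b'v b'b2.
have [Q' Q'E] := top_exists ub.
have [|||c [uc bc M0E]] := @slide_cases _ (phi^-1 M')%g S Q' u b ub _ SE Q'E.
- by rewrite aut_card ?groupV // (slide_dim M'E).
- by rewrite -(aut_mono _ _ Aphi) permKV (fix_star SE) (star_le_slide ub' SE M'E).
- by rewrite -(aut_mono _ _ Aphi) permKV (fix_top ub Q'E) (slide_le_top ub' bb' M'E Q'E).
case: (@slides_unbounded _ u v b c M (phi^-1 M')%g (phi^-1 N)%g) => //.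
  by rewrite -(aut_mono _ _ Aphi) permKV.
by rewrite -(aut_mono _ _ Aphi) !permKV.
Qed.

(** Stated over all realignments with the given data, so that it can be used for
    a parent function before it is known to describe a tree. *)
Definition fixed_tree c p := forall T, val T = cell_data c setT p id -> phi T = T.

Lemma eq_fixed_tree c p p' : {in [set~ c], p =1 p'} -> fixed_tree c p -> fixed_tree c p'.
Proof.
move=> pp' fp T TE; apply: fp; rewrite TE; apply/esym/eq_cell_data => x.
  by rewrite !inE andbT => xc; apply: pp'; rewrite !inE.
by rewrite !inE.
Qed.

Lemma fixed_tree_star c : fixed_tree c (fun=> c).
Proof. by move=> T; apply: fix_star. Qed.

(** The edge from the star is fixed, and so is its other end. *)
Lemma fixed_tree_slide u v b : u != v -> u != b -> v != b ->
  fixed_tree u (upd (fun=> u) b v).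
Proof.
move=> uv ub vb T TE; have n2 : 1 < n by lia.
have [M ME] := slide_exists uv ub vb.
have TM : (T <= M)%O.
  apply: (le_cell TE ME); first by rewrite !inE.
  - exact: subsetT.
  - by move=> x; rewrite !inE => /andP[_ xb]; rewrite updNE.
  - by move=> x; rewrite !inE andbT negbK => /eqP->; rewrite updE eqxx orbT.
  by move=> x; rewrite !inE.
have phiTM : (phi T <= M)%O by rewrite -(fix_slide uv ub vb ME) aut_mono.
have TT : tv T = setT by rewrite /tv TE.
have [|f [fE fu fb]] := vertex_of_cell ME _ phiTM (aut_vertex Aphi TT); first by rewrite !inE.
have : f b \in [set u; v] by apply: fb; rewrite !inE negbK.
have fx x : x != b -> f x = u by move=> xb; apply: fu; rewrite !inE.
rewrite !inE => /orP[] /eqP fbE.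
  have phiTS : val (phi T) = star_data u.
    rewrite fE; apply: eq_cell_data => x; rewrite !inE ?andbT // => _.
    by have [->|/fx] := eqVneq x b.
  by apply: (@perm_inj _ phi); apply: fix_star phiTS.
apply: val_inj; rewrite fE TE; apply: eq_cell_data => x; rewrite !inE ?andbT // => _.
by rewrite /upd; case: eqVneq => [->|/fx].
Qed.

Lemma vertex_exists c p d : rooted c setT p d -> exists T, val T = cell_data c setT p id.
Proof.
move=> rT; have TP : is_realignment (cell_data c setT p id).
  by apply: (is_realignment_cell rT) => [|b]; rewrite ?cardsT ?card_ord ?inE //; lia.
by exists (Realignment TP).
Qed.

Lemma raise_exists c p d b : rooted c setT p d -> deep_leaf c p b ->
  exists M, val M = cell_data c [set~ b] p (p \o p).
Proof.
move=> rT bdeep; have rb := rooted_del rT bdeep; rewrite setTD in rb.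
have /deep_leafP[bc pbc bleaf] := bdeep.
have MP : is_realignment (cell_data c [set~ b] p (p \o p)).
  apply: (is_realignment_cell rb) => [|x].
    by rewrite cardsCs setCK cards1 card_ord; lia.
  by rewrite !inE negbK => /eqP->; rewrite setUC /= mem_parent_edges // !inE bleaf.
by exists (Realignment MP).
Qed.

(** The two trees are the ends of the edge along which [b] slides. *)
Lemma fixed_raise c p d b : rooted c setT p d -> deep_leaf c p b ->
    fixed_tree c p -> fixed_tree c (upd p b (p (p b))) ->
  forall M, val M = cell_data c [set~ b] p (p \o p) -> phi M = M.
Proof.
move=> rT bdeep fp fp1 M ME; have /deep_leafP[bc pbc bleaf] := bdeep.
have r1 := rooted_raise rT bdeep.
have [T TE] := vertex_exists rT; have [T1 T1E] := vertex_exists r1.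
have TT : tv T = setT by rewrite /tv TE.
have T1T : tv T1 = setT by rewrite /tv T1E.
have TM : (T <= M)%O.
  apply: (le_cell TE ME); first by rewrite !inE eq_sym.
  - exact: subsetT.
  - by [].
  - by move=> x _; rewrite !inE eqxx.
  by move=> x; rewrite !inE.
have T1M : (T1 <= M)%O.
  apply: (le_cell T1E ME); first by rewrite !inE eq_sym.
  - exact: subsetT.
  - by move=> x; rewrite !inE => /andP[_ xb]; rewrite updNE.
  - by move=> x; rewrite !inE andbT negbK => /eqP->; rewrite updE eqxx orbT.
  by move=> x; rewrite !inE.
have neqT : T != T1.
  apply/eqP => TT1; have : [set p (p b); b] \in te T.
    by rewrite TT1 /te T1E; apply/parent_edgesP; exists b; rewrite ?updE // !inE bc.
  rewrite /te TE => ppb; have ppE : p (p b) = p b.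
    apply: (@leaf_edge _ c setT) ppb; first by rewrite inE.
    by move=> z; rewrite !inE andbT; apply: bleaf.
  case: rT => _ _ dS; have [|_] := dS (p b); first by rewrite !inE pbc.
  by rewrite ppE; lia.
have dimM : #|tv M|.+1 = n.
  by rewrite /tv ME /= cardsCs setCK cards1 card_ord; lia.
apply: (@edge_unique _ _ _ T T1) => //; first by rewrite aut_card.
  by rewrite -(fp T TE) aut_mono.
by rewrite -(fp1 T1 T1E) aut_mono.
Qed.

(** Two edges of the square have fixed ends, hence are fixed; they determine the
    square, which is therefore fixed. The image of the fourth vertex is then a
    vertex of the square, and the other three are already taken. *)
Lemma fixed_square c p d b b' : rooted c setT p d -> b != b' ->
    deep_leaf c p b -> deep_leaf c p b' ->
    fixed_tree c (upd p b (p (p b))) -> fixed_tree c (upd p b' (p (p b'))) ->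
    fixed_tree c (upd (upd p b (p (p b))) b' (p (p b'))) ->
  fixed_tree c p.
Proof.
move=> rT bb' bdeep b'deep fp1 fp2 fp0 T TE.
have b'b : b' != b by rewrite eq_sym.
have /deep_leafP[bc pbc bleaf] := bdeep; have /deep_leafP[b'c pb'c b'leaf] := b'deep.
set p1 := upd p b _ in fp1 fp0; set p2 := upd p b' _ in fp2.
have r1 : rooted c setT p1 _ := rooted_raise rT bdeep.
have r2 : rooted c setT p2 _ := rooted_raise rT b'deep.
have deep1 : deep_leaf c p1 b' by apply: deep_leaf_raise.
have deep2 : deep_leaf c p2 b by apply: deep_leaf_raise.
have p1E : p1 (p1 b') = p (p b') by rewrite /p1 (updNE _ _ b'b) updNE ?bleaf.
have p2E : p2 (p2 b) = p (p b) by rewrite /p2 (updNE _ _ bb') updNE ?b'leaf.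
have [M1 M1E] := raise_exists r1 deep1.
have [M2 M2E] := raise_exists r2 deep2.
have fM1 : phi M1 = M1.
  by apply: (fixed_raise r1 deep1 fp1 _ M1E); rewrite p1E.
have fM2 : phi M2 = M2.
  apply: (fixed_raise r2 deep2 fp2 _ M2E); apply: eq_fixed_tree fp0 => x _.
  rewrite p2E /p2 /p1 /upd; case: (eqVneq x b) => // ->; by rewrite (negPf bb').
pose A := ~: [set b; b'].
have inA x : (x \in A) = (x != b) && (x != b') by rewrite !inE negb_or.
have Ac : c \in A by rewrite inA ![c == _]eq_sym bc b'c.
have [N NE] : exists N, val N = cell_data c A p (p \o p).
  have rA : rooted c A p d.
    have -> : A = setT :\ b :\ b' by apply/setP => x; rewrite inA !inE andbT andbC.
    exact: rooted_del (rooted_del rT bdeep) b'deep.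
  have NP : is_realignment (cell_data c A p (p \o p)).
    apply: (is_realignment_cell rA) => [|x].
      by rewrite cardsCs setCK cards2 bb' card_ord; lia.
    rewrite inE inA negb_and !negbK => /orP[] /eqP->; rewrite setUC /= mem_parent_edges //.
      by rewrite inA bleaf ?b'leaf.
    by rewrite inA bleaf ?b'leaf.
  by exists (Realignment NP).
have M1N : (M1 <= N)%O.
  apply: (le_cell M1E NE) => //.
  - by apply/subsetP => x; rewrite inA !inE => /andP[].
  - by move=> x; rewrite in_setD1 inA => /and3P[_ xb _]; rewrite /p1 updNE.
  - move=> x; rewrite inE inA negb_and !inE !negbK => /andP[/orP[]/eqP-> //].
      by rewrite /p1 updE eqxx orbT.
    by rewrite eqxx.
  move=> x; rewrite !inE negbK => /eqP->.
  by rewrite /= p1E /p1 updNE.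
have M2N : (M2 <= N)%O.
  apply: (le_cell M2E NE) => //.
  - by apply/subsetP => x; rewrite inA !inE => /andP[].
  - by move=> x; rewrite in_setD1 inA => /and3P[_ _ xb]; rewrite /p2 updNE.
  - move=> x; rewrite inE inA negb_and !inE !negbK => /andP[/orP[]/eqP-> //].
      by rewrite eqxx.
    by rewrite /p2 updE eqxx orbT.
  move=> x; rewrite !inE negbK => /eqP->.
  by rewrite /= p2E /p2 updNE.
have fN : phi N = N.
  apply/esym/(eq_of_two_faces M1N M2N); rewrite ?aut_card //.
  - by rewrite -fM1 aut_mono.
  - by rewrite -fM2 aut_mono.
  by rewrite /tv M1E M2E NE; apply/subsetP => x; rewrite inA !inE andbC.
have TN : (T <= N)%O.
  apply: (le_cell TE NE); rewrite ?subsetT //.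
    by move=> x _; rewrite !inE eqxx.
  by move=> x; rewrite !inE.
have TT : tv T = setT by rewrite /tv TE.
have phiTN : (phi T <= N)%O by rewrite -fN aut_mono.
have [f [fE fA fNA]] := vertex_of_cell NE Ac phiTN (aut_vertex Aphi TT).
have fx x : x != b -> x != b' -> f x = p x by move=> xb xb'; apply: fA; rewrite inA xb.
(* If [phi T] is one of the fixed vertices, it equals its own image. *)
have fixf q : fixed_tree c q -> f =1 q -> phi T = T.
  move=> fq fqE; apply: (@perm_inj _ phi); apply: fq; rewrite fE.
  by apply: eq_cell_data => x; rewrite ?fqE // !inE.
have : f b \in [set p b; p (p b)] by apply: fNA; rewrite inE inA eqxx.
have : f b' \in [set p b'; p (p b')] by apply: fNA; rewrite inE inA eqxx andbF.
rewrite !inE => /orP[]/eqP fb' /orP[]/eqP fb.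
- apply: val_inj; rewrite fE TE; apply: eq_cell_data => x; rewrite !inE // => _.
  by have [->//|xb] := eqVneq x b; have [->//|xb'] := eqVneq x b'; apply: fx.
- apply: (fixf _ fp1) => x; rewrite /p1 /upd; case: eqVneq => [->//|xb].
  by have [->//|xb'] := eqVneq x b'; apply: fx.
- apply: (fixf _ fp2) => x; rewrite /p2 /upd; case: eqVneq => [->//|xb'].
  by have [->//|xb] := eqVneq x b; apply: fx.
apply: (fixf _ fp0) => x; rewrite /p1 /upd; case: (eqVneq x b') => [->//|xb'].
by case: (eqVneq x b) => [->//|xb]; apply: fx.
Qed.

End FixedTrees.

Section TrivialKernel.
Variables (n : nat) (phi : {perm realignment n}).
Hypotheses (hn : 5 <= n) (Aphi : phi \in AutX n).
Hypothesis fix_star : forall u S, val S = star_data u -> phi S = S.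
Implicit Types (M N K T S Q : realignment n) (c b u v w x : 'I_n) (A : {set 'I_n}).
Implicit Types (p g : 'I_n -> 'I_n) (d : 'I_n -> nat).

(** The root varies during the induction: with a single deep leaf [b] the tree is
    fixed by the induction hypothesis for the root [branch p d b]. *)
Lemma fixed_tree_height h c p d :
  rooted c setT p d -> (forall x, d x <= h) -> fixed_tree phi c p.
Proof.
elim: h c p d => [|h IHh] c p d.
  move=> rT d0; apply: (@eq_fixed_tree _ phi c (fun=> c)); last exact: fixed_tree_star.
  by move=> x; rewrite !inE => xc; rewrite (depth_le1 rT) //; have := d0 x; lia.
have [k] := ubnP (\sum_x d x); elim: k p d => // k IHk p d ltk rT dh.
(* A vertex of maximal depth is a leaf, so a tree of height at least two has a deep
   leaf. *)
pose b := [arg max_(x > c) d x].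
have bmax x : d x <= d b by rewrite /b; case: arg_maxnP => // y _; apply.
have [db1 | db2] := leqP (d b) 1.
  apply: (@eq_fixed_tree _ phi c (fun=> c)); last exact: fixed_tree_star.
  by move=> x; rewrite !inE => xc; rewrite (depth_le1 rT) // (leq_trans (bmax x)).
have bdeep : deep_leaf c p b by apply: (@deepest_leaf _ c p d b predT).
have /deep_leafP[bc pbc bleaf] := bdeep.
case: (pickP (fun b' => (b' != b) && deep_leaf c p b')) => [b' /andP[b'b b'deep] | uniq_leaf].
  have bb' : b != b' by rewrite eq_sym.
  have [b'c _ _] := deep_leafP _ _ _ b'deep.
  have dup d' y : (forall x, d' x <= h.+1) -> forall x, upd d' y (d' y).-1 x <= h.+1.
    by move=> dh' x; rewrite /upd; case: eqP => // _; rewrite (leq_trans (leq_pred _)).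
  have r1 := rooted_raise rT bdeep; have r2 := rooted_raise rT b'deep.
  have deep1 := deep_leaf_raise bdeep b'deep bb'.
  have r0 := rooted_raise r1 deep1.
  have lt1 := sum_depth_raise rT bc; have lt2 := sum_depth_raise rT b'c.
  have lt0 := sum_depth_raise r1 b'c.
  apply: (fixed_square hn Aphi rT bb' bdeep b'deep).
  - by apply: (IHk _ _ _ r1); [lia | apply: dup].
  - by apply: (IHk _ _ _ r2); [lia | apply: dup].
  have pE : upd p b (p (p b)) (upd p b (p (p b)) b') = p (p b').
    by rewrite (updNE _ _ b'b) updNE ?bleaf.
  by rewrite -pE; apply: (IHk _ _ _ r0); [lia | exact: dup _ _ (dup _ _ dh)].
have [db_le2 | db3] := leqP (d b) 2.
  (* Any vertex of depth two is now a deep leaf, hence [b]: the tree is a neighbour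
     of the star at [c]. *)
  apply: (@eq_fixed_tree _ phi c (upd (fun=> c) b (p b))).
    move=> x; rewrite !inE /upd => xc; case: eqVneq => [-> // | xb].
    apply/esym/(depth_le1 rT xc); rewrite leqNgt; apply/negP => dx.
    have := uniq_leaf x; rewrite xb /= => /negP; apply.
    apply: (@deepest_leaf _ c p d x predT) => // y _.
    by rewrite (leq_trans (bmax y)) // (leq_trans db_le2).
  apply: (fixed_tree_slide hn Aphi fix_star); rewrite 1?eq_sym //.
  by rewrite eq_sym bleaf.
(* A deepest vertex outside the branch of [b] would be a second deep leaf, so the
   root can be moved to that branch, which lowers the height as it is at least
   three. *)
pose y := branch p d b.
have dy : d y = 1 by apply: depth_branch rT bc.
have bry x : 2 <= d x -> branch p d x = y.
  move=> dx; apply/eqP/negPn/negP => brx.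
  pose P x := (2 <= d x) && (branch p d x != y).
  have Px : P x by rewrite /P dx.
  pose b' := [arg max_(z > x | P z) d z].
  have [/andP[db' brb'] b'max] : P b' /\ forall z, P z -> d z <= d b'.
    by rewrite /b'; case: arg_maxnP => // z Pz zmax; split.
  have b'deep : deep_leaf c p b'.
    apply: (@deepest_leaf _ c p d b' P) => //; first exact/andP.
    move=> z dz /andP[_ brz]; rewrite /P dz.
    by rewrite (branch_parent rT).
  have b'b : b' != b by apply: contraNneq brb' => ->.
  by have := uniq_leaf b'; rewrite b'b b'deep.
have fy : fixed_tree phi y (upd p c y).
  apply: IHh (reroot rT dy bry) _ => x.
  by have := dh x; have := dh b; do !case: ifP => ?; lia.
move=> T TE; apply: fy; rewrite TE /cell_data (reroot_edges rT dy).
by congr (_, _, _); apply/ffunP => x; rewrite !ffunE !inE.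
Qed.

Lemma fix_vertex T : tv T = setT -> phi T = T.
Proof.
have [c _] := @ord_avoid n [::] (ltnW (ltnW (ltnW (ltnW hn)))).
move=> /(vertex_cell c)[p [d [rT TE]]].
apply: (fixed_tree_height (h := \max_x d x) rT) TE => x; exact: leq_bigmax.
Qed.

(** Induction on the dimension: an edge is determined by its two ends, and a
    cube of dimension at least two by two facets in different directions. *)
Lemma fix_cell N : phi N = N.
Proof.
have [k] := ubnP (n - #|tv N|); elim: k N => // k IHk N ltk.
have [NT | [b]] := set_0Vmem (~: tv N).
  by apply: fix_vertex; rewrite -[LHS]setCK NT setC0.
rewrite inE => nb.
have face b' (v : 'I_n) : in_edge (ra N b') v -> exists K,
    [/\ tv K = b' |: tv N, te K = [set v; b'] |: te N, (K <= N)%O & phi K = K].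
  move=> bv; have [K [KE NK]] := specialize_in bv; exists K.
  have tvK : tv K = b' |: tv N by rewrite /tv KE.
  split=> //; [by rewrite /te KE | exact: connect1 | apply: IHk].
  have [e [_ _ nb' _ _]] := in_edgeE bv.
  have : #|tv K| <= n by rewrite -[X in _ <= X]card_ord max_card.
  by rewrite tvK cardsU1 nb'; lia.
have [e rb _] := reattach_Some nb.
have [_ _ _ /eqP/cards2P[v [w [vw eE]]]] := reattach_edge rb.
have [|K [tvK teK KN fK]] := face b v; first by rewrite rb /= eE !inE eqxx.
have KN' : (K <= phi N)%O by rewrite -fK aut_mono.
have [D0 | [b']] := set_0Vmem (~: tv K).
  have KT : tv K = setT by rewrite -[LHS]setCK D0 setC0.
  have [|L [tvL teL LN fL]] := face b w; first by rewrite rb /= eE !inE eqxx orbT.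
  have LN' : (L <= phi N)%O by rewrite -fL aut_mono.
  have LT : tv L = setT by rewrite tvL -tvK.
  have dimN : #|tv N|.+1 = n.
    by rewrite -[RHS]card_ord -cardsT -KT tvK cardsU1 nb.
  apply: (@edge_unique _ (phi N) N K L) => //; first by rewrite aut_card.
  apply/eqP => KL; have : [set v; b] \in te L by rewrite -KL teK setU11.
  rewrite teL !inE => /orP[/eqP | /edge_sub].
    by rewrite setUC [RHS]setUC => /set2_inj_r vwE; rewrite vwE eqxx in vw.
  by rewrite subUset !sub1set (negPf nb) andbF.
rewrite inE tvK !inE negb_or => /andP[b'b nb'].
have [e' rb' _] := reattach_Some nb'.
have [_ _ _ /eqP/cards2P[v' [w' [_ e'E]]]] := reattach_edge rb'.
have [|L [tvL teL LN fL]] := face b' v'; first by rewrite rb' /= e'E !inE eqxx.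
have LN' : (L <= phi N)%O by rewrite -fL aut_mono.
apply/esym/(eq_of_two_faces KN LN KN' LN'); last by rewrite aut_card.
apply/subsetP => x; rewrite tvK tvL !inE.
by case: (x \in tv N) => //=; rewrite !orbF => /andP[/eqP-> ]; rewrite eq_sym (negPf b'b).
Qed.

End TrivialKernel.

(** * The symmetric group acting by relabelling *)

Section Relabelling.
Variable n : nat.
Implicit Types (s t : 'S_n) (N M : realignment n) (D : realign_data n).
Local Open Scope group_scope.

Definition relabel_data s D : realign_data n :=
  (s @: tv D, [set s @: e | e : {set 'I_n} in te D],
   [ffun x => omap (fun e : {set 'I_n} => s @: e) (ra D (s^-1 x))]).

Lemma imset_set2 s (x y : 'I_n) : s @: [set x; y] = [set s x; s y].
Proof. by rewrite imsetU1 imset_set1. Qed.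

(** Carrying over a parent function, rather than paths and cycles, shows that
    relabelling preserves trees. *)
Lemma rooted_relabel s c A p d : rooted c A p d ->
  rooted (s c) (s @: A) (s \o p \o s^-1) (d \o s^-1).
Proof.
case=> Ac dc dS; split; rewrite /= ?permK ?imset_f //.
move=> y /setD1P[ysc /imsetP[x Ax yE]]; move: ysc; rewrite {y}yE /= !permK => sxc.
have [|pxA dx] := dS x; last by rewrite imset_f.
by rewrite !inE Ax andbT -(inj_eq (@perm_inj _ s)).
Qed.

Lemma parent_edges_relabel s c A (p : 'I_n -> 'I_n) :
  [set s @: e | e : {set 'I_n} in parent_edges c A p]
    = parent_edges (s c) (s @: A) (s \o p \o s^-1).
Proof.
rewrite /parent_edges -imset_comp.
have -> : s @: A :\ s c = s @: (A :\ c).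
  apply/setP => y; rewrite -[y](permKV s) !(inE, mem_imset) ?(inj_eq perm_inj) //; exact: perm_inj.
rewrite -imset_comp; apply: eq_imset => x /=.
by rewrite imset_set2 permK.
Qed.

Lemma is_realignment_relabel s N : is_realignment (relabel_data s N).
Proof.
have s_inj := @perm_inj _ s; apply/and3P; split.
- by rewrite card_imset // realign_card.
- have /card_gt0P[c Ac] : 0 < #|tv N| by rewrite (ltn_trans _ (realign_card N)).
  have [p [d [rA EE]]] := tree_rooted (realign_tree N) Ac.
  rewrite -[te _]/[set s @: e | e : {set 'I_n} in te N] EE parent_edges_relabel.
  exact: rooted_tree (rooted_relabel s rA).
apply/forallP => b; rewrite /ra /= ffunE.
have := reattach_None N (s^-1 b); rewrite -(mem_imset _ _ s_inj) permKV.
rewrite -[tv (_, _, _)]/(s @: tv N) -[te (_, _, _)]/[set s @: e | e : {set 'I_n} in te N].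
case rb: (ra N _) => [e|] //= => <- //.
have [nb Ee _ _] := reattach_edge rb.
by rewrite imset_f.
Qed.

Definition relabel s N := Realignment (is_realignment_relabel s N).

Lemma relabelM s t N : relabel (s * t) N = relabel t (relabel s N).
Proof.
apply: val_inj; congr (_, _, _).
- by rewrite /tv /= -imset_comp; apply: eq_imset => x; rewrite permM.
- rewrite /te /= -imset_comp; apply: eq_imset => e /=.
  by rewrite -imset_comp; apply: eq_imset => x; rewrite permM.
apply/ffunP => x; rewrite !ffunE invMg permM.
case: (ra N _) => //= e; congr Some.
by rewrite -imset_comp; apply: eq_imset => y; rewrite permM.
Qed.

Lemma relabel1 N : relabel 1 N = N.
Proof.
have im1 (A : {set 'I_n}) : (1 : 'S_n) @: A = A.
  by rewrite -[RHS]imset_id; apply: eq_imset => x; rewrite perm1.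
apply: val_inj; rewrite [RHS]surjective_pairing [(val N).1]surjective_pairing /=.
congr (_, _, _); first exact: im1.
  rewrite -[RHS]imset_id; apply: eq_imset => e; exact: im1.
apply/ffunP => x; rewrite ffunE invg1 perm1 /ra; case: (_ x) => //= e.
by rewrite im1.
Qed.

Lemma relabel_specializes s N M : specializes N M -> specializes (relabel s N) (relabel s M).
Proof.
case/specializesP=> b [v [bv ME]]; apply/specializesP; exists (s b), (s v).
have raE x : ra (relabel s N) (s x) = omap (fun e : {set 'I_n} => s @: e) (ra N x).
  by rewrite /ra ffunE permK.
split; first by rewrite raE; case: (ra N b) bv => //= e ve; apply: imset_f.
rewrite /= /relabel_data ME /specify_data /tv /te /=; congr (_, _, _).
- by rewrite imsetU1.
- by rewrite imsetU1 imset_set2.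
apply/ffunP => x; rewrite !ffunE -[x](permKV s) (inj_eq perm_inj) permKV.
by case: eqP.
Qed.

Lemma relabel_le s N M : (relabel s M <= relabel s N)%O = (M <= N)%O.
Proof.
have mono t K L : (L <= K)%O -> (relabel t L <= relabel t K)%O.
  rewrite !leEface => /connectP[q + ->]; elim: q K => [|K' q IHq] K /=.
    by move=> _; apply: connect0.
  case/andP=> /(relabel_specializes t) /connect1 /connect_trans KK' /IHq; exact: KK'.
apply/idP/idP => [/(mono s^-1)|]; last exact: mono.
by rewrite -!relabelM mulgV !relabel1.
Qed.

Lemma relabel_inj s : injective (relabel s).
Proof.
by apply: (can_inj (g := relabel s^-1)) => N; rewrite -relabelM mulgV relabel1.
Qed.

Definition relabel_perm s : {perm realignment n} := perm (@relabel_inj s).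

Lemma relabel_permM : {in [set: 'S_n] &, {morph relabel_perm : s t / s * t}}.
Proof. by move=> s t _ _; apply/permP => N; rewrite permM !permE relabelM. Qed.

Canonical relabel_morphism := Morphism relabel_permM.

Lemma relabel_star s u N : val N = star_data u -> val (relabel s N) = star_data (s u).
Proof.
move=> NE; rewrite /= /relabel_data /tv /te /ra NE /star_data /cell_data /=.
have imT : s @: setT = setT.
  by apply/eqP; rewrite eqEcard subsetT card_imset ?leqnn //; apply: perm_inj.
congr (_, _, _) => //.
  by rewrite parent_edges_relabel imT; apply: eq_imset.
by apply/ffunP => x; rewrite !ffunE !inE.
Qed.

Lemma relabel_aut s : relabel_perm s \in AutX n.
Proof. by apply/poset_autP => M N; rewrite !permE relabel_le. Qed.

End Relabelling.

(** * The automorphism group *)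

(** Stars with different centres are different trees, so the map induced on the
    centres is injective. *)
Lemma aut_star_perm n (phi : {perm realignment n}) : 2 < n -> phi \in AutX n ->
  exists s : 'S_n, forall u S, val S = star_data u -> val (phi S) = star_data (s u).
Proof.
move=> n3 Aphi; have n2 : 1 < n := ltnW n3.
have [f fP] : exists f : 'I_n -> 'I_n, forall u S, val S = star_data u -> val (phi S) = star_data (f u).
  apply: (@fin_all_exists 'I_n (fun=> 'I_n) (fun u w => forall S, val S = star_data u -> val (phi S) = star_data w)) => u.
  have [S SE] := star_exists u n2; have [w wE] := aut_star n3 Aphi SE.
  exists w => S' S'E; suff -> : S' = S by [].
  by apply: val_inj; rewrite SE S'E.
have f_inj : injective f.
  move=> u v fuv; have [S SE] := star_exists u n2; have [S' S'E] := star_exists v n2.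
  apply: (star_data_inj n3); rewrite -SE -S'E; congr val; apply: (@perm_inj _ phi).
  by apply: val_inj; rewrite (fP _ _ SE) (fP _ _ S'E) fuv.
by exists (perm f_inj) => u S SE; rewrite permE; apply: fP.
Qed.

Theorem theorem4p14 (n : nat) (hn : 5 <= n) : AutX n \isog [set: 'S_n].
Proof.
have n3 : 2 < n by lia.
rewrite isog_sym; apply/isogP; exists (relabel_morphism n).
  apply/injmP => s t _ _ st; apply/permP => u.
  have [S SE] := star_exists u (ltnW n3).
  apply: (star_data_inj n3); rewrite -!(relabel_star _ SE); congr val.
  by have := congr1 (fun r : {perm _} => r S) st; rewrite /= !permE.
apply/setP => phi; apply/morphimP/idP => [[s _ _ ->] | Aphi]; first exact: relabel_aut.
have [s phiS] := aut_star_perm n3 Aphi.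
exists s; rewrite ?inE //=; apply/permP => N.
have psiA : (phi * (relabel_perm s)^-1)%g \in AutX n.
  by rewrite groupM ?groupV ?relabel_aut.
have fixS u S : val S = star_data u -> (phi * (relabel_perm s)^-1)%g S = S.
  move=> SE; apply: (@perm_inj _ (relabel_perm s)); rewrite permM permKV permE.
  by apply: val_inj; rewrite (relabel_star s SE) (phiS _ _ SE).
have := fix_cell hn psiA fixS N; rewrite permM => /(congr1 (relabel_perm s)).
by rewrite permKV.
Qed.
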